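(* Let $G$ be a block-rigid $CRQ$-group of ring type with $\mathrm{Reg}\,G=A$. Fix a principal decomposition $G=G_1\oplus C$, put $B=\mathrm{Reg}\,G_1$, and fix an element $d$, an $r$-basis $E=\{e_i^{(\tau)}\mid \tau\in T(G),\ i\in I_\tau\}$ of $G$, and the corresponding standard representation $d=\sum_{\tau\in T(B)}\frac{s_\tau}{m_\tau}e_0^{(\tau)}$ (all as defined in the context). Let $$g=\sum_{\tau\in T(B)}\frac{r_\tau}{m_\tau}e_0^{(\tau)}+\sum_{\tau\in T(C)}\sum_{i\in I_\tau(C)}a_i^{(\tau)}e_i^{(\tau)}\in G,$$ where $r_\tau\in R_\tau$ for $\tau\in T(B)$ and $a_i^{(\tau)}\in R_\tau$ for $\tau\in T(C)$, $i\in I_\tau(C)$. Set $r_\tau=0$ for $\tau\in T(G)\setminus T(B)$ (and recall that $I_\tau(C)=\varnothing$ for $\tau\notin T(C)$), and for each $\tau\in T(G)$ set $$\ell_\tau(g)=\gcd\bigl(\{\overline{r_\tau}\}\cup\{\overline{a_i^{(\tau)}}\mid i\in I_\tau(C)\}\bigr).$$ Then the principal absolute ideal $\langle g\rangle_{AI}$ of $G$ generated by $g$ satisfies $$\langle g\rangle_{AI}=\langle g\rangle+\bigoplus_{\tau\in T(B)}r_\tau A_\tau+\bigoplus_{\tau\in T(C)}\Bigl(\sum_{i\in I_\tau(C)}a_i^{(\tau)}A_\tau\Bigr)=\langle g\rangle+\bigoplus_{\tau\in T(G)}\ell_\tau(g)A_\tau .$$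
   Context: All groups are abelian and written additively; $\langle S\rangle$ is the subgroup generated by $S$, and $\tilde G$ is the divisible hull of $G$. Absolute ideals. A multiplication on a group $G$ is a homomorphism $\mu:G\otimes G\to G$, written $g_1\times g_2=\mu(g_1\otimes g_2)$; $G$ with a multiplication is called a ring on $G$ (no associativity, commutativity or unit is required). A subgroup of $G$ is an absolute ideal of $G$ if it is a (two-sided) ideal in every ring on $G$. For $g\in G$, $\langle g\rangle_{AI}$ is the least absolute ideal of $G$ containing $g$. Types. For a type $\tau$ and a prime $p$, $\tau(p)$ is the component of $\tau$ at $p$. A type is idempotent if it is represented by a characteristic with all entries in $\{0,\infty\}$; for an idempotent type, $\tau(p)$ denotes the entry of this characteristic. Let $P$ be the set of primes, $P_\infty(\tau)=\{p\in P\mid\tau(p)=\infty\}$, $P_0(\tau)=P\setminus P_\infty(\tau)$. For $P_1\subseteq P$, a $P_1$-number is a non-zero integer all of whose prime factors (if any) lie in $P_1$. For an idempotent type $\tau$, $R_\tau$ is the unital subring of $\mathbb{Q}$ whose additive group has type $\tau$, i.e. $R_\tau=\mathbb{Z}[1/p\mid p\in P_\infty(\tau)]$. Every $a\in R_\tau\setminus\{0\}$ can be written uniquely as $a=\overline{a}\,y$ with $\overline{a}$ a positive $P_0(\tau)$-number and $y$ a quotient of two $P_\infty(\tau)$-numbers; this defines $\overline{a}$ for $a\neq 0$, and $\overline{0}=0$. The gcd of a finite set of integers is the nonnegative generator of the ideal of $\mathbb{Z}$ they generate (so it is $0$ if all of them are $0$). Groups. A torsion-free group $G$ of finite rank is almost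 completely decomposable (an $ACD$-group) if it contains a completely decomposable subgroup of finite index. Its regulator $\mathrm{Reg}\,G$ is the intersection of all regulating subgroups (completely decomposable subgroups of least possible index in $G$); it is a completely decomposable fully invariant subgroup of finite index. $G$ is a $CRQ$-group if $G/\mathrm{Reg}\,G$ is cyclic. Write $\mathrm{Reg}\,G$ as a direct sum of rank-one groups; for a type $\tau$, $\mathrm{Reg}_\tau G$ is the sum of the rank-one summands of type $\tau$, and $T(G)=T(\mathrm{Reg}\,G)=\{\tau\mid\mathrm{Reg}_\tau G\neq 0\}$ is the set of critical types. $G$ is block-rigid if the types in $T(G)$ are pairwise incomparable; it is rigid if moreover every $\mathrm{Reg}_\tau G$, $\tau\in T(G)$, has rank $1$. $G$ is of ring type if all types in $T(G)$ are idempotent. For a completely decomposable group $X$ (such as $A=\mathrm{Reg}\,G$, $B$ or $C$), $X_\tau$ denotes its $\tau$-homogeneous component (which is uniquely determined when $X$ is block-rigid). The invariants $m_\tau$. Let $G$ be a block-rigid $CRQ$-group of ring type and $A=\mathrm{Reg}\,G=\bigoplus_{\tau\in T(G)}A_\tau$. Then $\tilde G=\bigoplus_{\tau\in T(G)}\tilde A_\tau$, with projections $\pi_\tau:\tilde G\to\tilde A_\tau$. For $\tau\in T(G)$, $m_\tau=m_\tau(G)$ is the order of the finite cyclic group $\pi_\tau(G)/A_\tau$. Principal decomposition. A principal decomposition of $G$ is a direct decomposition $G=G_1\oplus C$, where $C$ is a block-rigid completely decomposable group and $G_1$ is a rigid $CRQ$-group such that, for $\tau\in T(G)$, $\tau\in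 T(G_1)$ if and only if $m_\tau(G)>1$, and $m_\tau(G_1)=m_\tau(G)$ for all $\tau\in T(G_1)$. Put $B=\mathrm{Reg}\,G_1$, so $T(B)=T(G_1)$ and $A_\tau=B_\tau\oplus C_\tau$ for $\tau\in T(G)$. Standard representation and $r$-basis. Let $d\in G_1$ satisfy $G/\mathrm{Reg}\,G=\langle d+\mathrm{Reg}\,G\rangle$. An $rc$-basis of $G$ defined by $d$ is a system $E_0=\{e_0^{(\tau)}\in B_\tau\mid\tau\in T(B)\}$ such that $B=\bigoplus_{\tau\in T(B)}R_\tau e_0^{(\tau)}$ and, in $\tilde B$, $$d=\sum_{\tau\in T(B)}\frac{s_\tau}{m_\tau}e_0^{(\tau)},$$ where $m_\tau=m_\tau(G)$, $s_\tau\in\mathbb{Z}$, $\gcd(s_\tau,m_\tau)=1$, and $s_\tau$ and $m_\tau$ are $P_0(\tau)$-numbers for all $\tau\in T(B)$. This expression for $d$ is the standard representation of $G$ related to $(d,E_0)$. For $\tau\in T(C)$ write $C_\tau=\bigoplus_{i\in I_\tau(C)}R_\tau e_i^{(\tau)}$ with $I_\tau(C)$ a non-empty finite subset of $\mathbb{N}=\{1,2,\dots\}$; set $I_\tau(C)=\varnothing$ for $\tau\notin T(C)$, $I_\tau(B)=\{0\}$ for $\tau\in T(B)$, $I_\tau(B)=\varnothing$ for $\tau\notin T(B)$, and $I_\tau=I_\tau(B)\cup I_\tau(C)$. The system $E=\{e_i^{(\tau)}\mid\tau\in T(G),\ i\in I_\tau\}$ is then called an $r$-basis of $G$ (its subsystem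 $E_0=\{e_0^{(\tau)}\mid\tau\in T(B)\}$ being an $rc$-basis). Since $G=\langle d,A\rangle$, every element of $G$ has the form displayed for $g$ in the claim. *)

(* Defs.v *)
From HB Require Import structures.
From mathcomp Require Import all_boot all_order all_algebra.
From mathcomp Require Import boolp classical_sets functions cardinality fsbigop.
Set Implicit Arguments.
Unset Strict Implicit.
Unset Printing Implicit Defensive.
Import Order.TTheory GRing.Theory Num.Theory.
Local Open Scope classical_set_scope.
Local Open Scope ring_scope.

(* Torsion-free groups of finite rank are exactly the additive subgroups of
   finite-dimensional rational vector spaces: every group below is a subset of
   an ambient [V : vectType rat], and the divisible hull of a subgroup is taken
   inside [V].  Sums over a set of indices are the finitely supported sums
   [\sum_(i \in D) x i] of fsbigop; they are only used on finite index sets. *)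

Definition primeT := {p : nat | prime p}.

(* [None] stands for the value infinity. *)
Definition charac := primeT -> option nat.

Definition charac_equiv (c1 c2 : charac) : Prop :=
  finite_set [set p | c1 p <> c2 p] /\ forall p, c1 p = None <-> c2 p = None.

Definition charac_equivb (c1 c2 : charac) : bool := `[< charac_equiv c1 c2 >].

Fact charac_equivb_refl : reflexive charac_equivb.
Proof.
move=> c; apply/asboolP; split=> //.
by rewrite (_ : [set _ | _] = set0) // -subset0 => p /=.
Qed.

Fact charac_equivb_sym : symmetric charac_equivb.
Proof.
have H c1 c2 : charac_equiv c1 c2 -> charac_equiv c2 c1.
  move=> [f h]; split=> [|p]; last by rewrite h.
  by apply: sub_finite_set f => p /= ne e; apply: ne.
by move=> c1 c2; apply/asboolP/asboolP; apply: H.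
Qed.

Fact charac_equivb_trans : transitive charac_equivb.
Proof.
move=> c2 c1 c3 /asboolP[f12 h12] /asboolP[f23 h23]; apply/asboolP.
split=> [|p]; last by rewrite h12.
have fU : finite_set ([set p | c1 p <> c2 p] `|` [set p | c2 p <> c3 p]).
  by rewrite finite_setU.
apply: sub_finite_set fU => p /= ne.
by have [e|] := pselect (c1 p = c2 p); [right; rewrite -e|left].
Qed.

Canonical charac_equiv_rel :=
  EquivRel charac_equivb charac_equivb_refl charac_equivb_sym
    charac_equivb_trans.

Definition gtype := {eq_quot charac_equivb}%qT.

Definition type_of_char (c : charac) : gtype := (\pi_gtype c)%qT.

Definition entry_le (u v : option nat) : Prop :=
  match u, v with
  | _, None => True
  | None, Some _ => False
  | Some m, Some n => (m <= n)%N
  end.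

Definition type_le (s t : gtype) : Prop :=
  exists c1 c2 : charac, [/\ type_of_char c1 = s, type_of_char c2 = t
    & forall p, entry_le (c1 p) (c2 p)].

Definition zero_infty (c : charac) : Prop :=
  forall p, c p = Some 0 \/ c p = None.

Definition idempotent_type (t : gtype) : Prop :=
  exists2 c, type_of_char c = t & zero_infty c.

(* An idempotent type is represented by a unique characteristic with entries
   in {0, infinity}. *)
Definition Pinf (t : gtype) : set primeT :=
  [set p | exists c, [/\ type_of_char c = t, zero_infty c & c p = None]].

Definition P0 (t : gtype) : set primeT := ~` Pinf t.

Definition P_number (P : set primeT) (z : int) : Prop :=
  z != 0 /\ forall p : primeT, (val p %| `|z|)%N -> P p.

(* The ring Z[1/p | t(p) = infinity]. *)
Definition Rt (t : gtype) : set rat :=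
  [set q | exists z w : int, P_number (Pinf t) w /\ q = z%:~R / w%:~R].

Definition bar (t : gtype) (a : rat) : nat :=
  if a == 0 then 0%N else
  xget 0%N [set n : nat | [/\ (0 < n)%N, P_number (P0 t) n%:Z
    & exists u v : int, [/\ P_number (Pinf t) u, P_number (Pinf t) v
                          & a = n%:R * (u%:~R / v%:~R)]]].

Section Groups.
Variable V : vectType rat.
Implicit Types (G H A C : set V) (x y g d : V) (t : gtype).

Definition subgroup H : Prop :=
  H 0 /\ forall x y, H x -> H y -> H (x - y).

Definition gen (S : set V) : set V := smallest subgroup S.

Definition hull H : set V := [set x | exists2 n, (0 < n)%N & H (x *+ n)].

Definition addset H K : set V := [set x + y | x in H & y in K].

Definition scaleset (q : rat) H : set V := [set q *: x | x in H].

Definition sumset (I : choiceType) (D : set I) (X : I -> set V) : set V :=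
  [set v | exists2 x : I -> V,
    (forall i, D i -> X i (x i)) & v = \sum_(i \in D) x i].

Definition independent (I : choiceType) (D : set I) (X : I -> set V) : Prop :=
  forall x : I -> V, (forall i, D i -> X i (x i)) ->
    \sum_(i \in D) x i = 0 -> forall i, D i -> x i = 0.

(* H is the direct sum of the free rank-one [R i]-modules generated by the [e i]. *)
Definition is_basis (I : choiceType) (D : set I) (R : I -> set rat)
    (e : I -> V) H : Prop :=
  H = [set v | exists2 a : I -> rat,
        (forall i, D i -> R i (a i)) & v = \sum_(i \in D) a i *: e i] /\
  forall a : I -> rat, (forall i, D i -> R i (a i)) ->
    \sum_(i \in D) a i *: e i = 0 -> forall i, D i -> a i = 0.

Definition has_index G H (n : nat) : Prop :=
  exists c : 'I_n -> V,
    (forall i, G (c i)) /\ forall g, G g -> exists! i, H (g - c i).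

(* The order of G / H when it is finite. *)
Definition index G H : nat := xget 0%N [set n | has_index G H n].

Definition cyclic_mod G H d : Prop := G d /\ G = addset (gen [set d]) H.

Definition rank1 H : Prop :=
  subgroup H /\ exists x, [/\ H x, x != 0
    & forall y, H y -> exists q : rat, y = q *: x].

Definition divides_in H x (n : nat) : Prop := exists2 y, H y & x = y *+ n.

Definition height H x : charac := fun p =>
  if `[< forall k, divides_in H x (val p ^ k)%N >] then None
  else Some (xget 0%N [set k | divides_in H x (val p ^ k)%N /\
                               ~ divides_in H x (val p ^ k.+1)%N]).

(* For H of rank one the type does not depend on the chosen non-zero element. *)
Definition type_of H : gtype :=
  type_of_char (height H (xget 0 [set x | H x /\ x != 0])).

Definition cd_decomp A (n : nat) (X : 'I_n -> set V) : Prop :=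
  [/\ forall i, rank1 (X i), independent setT X & A = sumset setT X].

Definition completely_decomposable A : Prop :=
  exists n (X : 'I_n -> set V), cd_decomp A X.

(* The sum of the rank-one summands of type t in a decomposition of A; for
   block-rigid A it is the same subgroup for all decompositions. *)
Definition homog A t : set V :=
  [set v | exists n (X : 'I_n -> set V),
     cd_decomp A X /\ sumset [set i | type_of (X i) = t] X v].

Definition crit A : set gtype := [set t | exists2 x, homog A t x & x != 0].

Definition ACD G : Prop :=
  subgroup G /\ exists A n, [/\ completely_decomposable A, A `<=` G
                              & has_index G A n].

Definition regulating G H : Prop :=
  [/\ completely_decomposable H, H `<=` G &
   exists2 n, has_index G H n &
     forall K k, completely_decomposable K -> K `<=` G -> has_index G K k ->
       (n <= k)%N].

Definition Reg G : set V := \bigcap_(H in regulating G) H.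

Definition CRQ G : Prop := ACD G /\ exists d, cyclic_mod G (Reg G) d.

Definition TG G : set gtype := crit (Reg G).

Definition block_rigid G : Prop :=
  forall s t, TG G s -> TG G t -> s <> t -> ~ type_le s t.

Definition rigid G : Prop :=
  block_rigid G /\ forall t, TG G t -> rank1 (homog (Reg G) t).

Definition ring_type G : Prop := forall t, TG G t -> idempotent_type t.

(* The projection of the hull of A onto the hull of its t-component. *)
Definition proj A t x : V :=
  xget 0 [set y | exists z : gtype -> V,
    [/\ forall s, crit A s -> hull (homog A s) (z s),
        x = \sum_(s \in crit A) z s & y = z t]].

Definition minv G t : nat :=
  index (proj (Reg G) t @` G) (homog (Reg G) t).

Definition principal_decomposition G G1 C : Prop :=
  [/\ [/\ subgroup G1, subgroup C, G = addset G1 C & G1 `&` C = [set 0]],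
      completely_decomposable C /\ block_rigid C,
      CRQ G1 /\ rigid G1,
      forall t, TG G t -> (TG G1 t <-> (1 < minv G t)%N)
    & forall t, TG G1 t -> minv G1 t = minv G t].

(* The elements [e t 0], for t critical for [B = Reg G1], form the rc-basis
   defined by d, and [s] gives the numerators in the standard representation
   of d. *)
Definition rc_basis G G1 d (e : gtype -> nat -> V) (s : gtype -> int) : Prop :=
  [/\ G1 d /\ cyclic_mod G (Reg G) d,
      forall t, TG G1 t -> homog (Reg G1) t (e t 0%N),
      is_basis (TG G1) Rt (e^~ 0%N) (Reg G1),
      d = \sum_(t \in TG G1) ((s t)%:~R / (minv G t)%:R) *: e t 0%N
    & forall t, TG G1 t ->
        [/\ coprimez (s t) (minv G t)%:Z, P_number (P0 t) (s t)
          & P_number (P0 t) (minv G t)%:Z]].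

(* [e t i] is only meaningful for t critical for [Reg G1] and i = 0, and for t
   critical for C and i in [IC t]. *)
Definition r_basis G G1 C d (IC : gtype -> set nat) (e : gtype -> nat -> V)
    (s : gtype -> int) : Prop :=
  [/\ rc_basis G G1 d e s,
      forall t, crit C t ->
        [/\ finite_set (IC t), IC t !=set0, ~ IC t 0%N
          & is_basis (IC t) (fun=> Rt t) (e t) (homog C t)]
    & forall t, ~ crit C t -> IC t = set0].

(* Homomorphisms from the tensor square of G to G are the biadditive maps. *)
Definition multiplication G (mu : V -> V -> V) : Prop :=
  [/\ forall x y, G x -> G y -> G (mu x y),
      forall x x' y, G x -> G x' -> G y -> mu (x + x') y = mu x y + mu x' y
    & forall x y y', G x -> G y -> G y' -> mu x (y + y') = mu x y + mu x y'].

Definition absolute_ideal G H : Prop :=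
  [/\ subgroup H, H `<=` G &
   forall mu, multiplication G mu ->
     forall g h, G g -> H h -> H (mu g h) /\ H (mu h g)].

Definition principal_AI G g : set V := smallest (absolute_ideal G) [set g].

Definition ell (IC : gtype -> set nat) (r : gtype -> rat)
    (a : gtype -> nat -> rat) t : nat :=
  gcdn (bar t (r t)) (\big[gcdn/0%N]_(i \in IC t) bar t (a t i)).

End Groups.

(* Main.v *)
Require Import Defs.
From HB Require Import structures.
From mathcomp Require Import all_boot all_order all_algebra.
From mathcomp Require Import finmap.
From mathcomp Require Import boolp classical_sets functions cardinality fsbigop.
Set Implicit Arguments.
Unset Strict Implicit.
Unset Printing Implicit Defensive.
Import Order.TTheory GRing.Theory Num.Theory.
Local Open Scope classical_set_scope.
Local Open Scope ring_scope.

(** Write [A = Reg G], [B = Reg G1].  Everything rests on two facts about the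
    structure of [G], which are obtained for block-rigid groups of ring type by
    looking at divisibility only.  Distinct critical types are idempotent and
    incomparable, so each inverts a prime that the other does not; hence the
    component [A_t] consists of the elements of [A] that are infinitely
    divisible by all primes inverted in [t] ([homogP]).  First, [A] is the direct
    sum of [B] and [C] and its components are pure in [G] ([Reg_sum],
    [homogA_pure]): the rank-one components of [B] are pure in [G1], since the
    sum of their purifications contains every completely decomposable subgroup
    of finite index and so is the regulator [B] itself ([rigid_homog_pure]), and
    a completely decomposable subgroup of finite index in [G] has the same types
    as [B] plus [C] ([cd_types_sub]), which places its summands in the pure
    components of [B] plus [C].  Second, every
    additive endomorphism of [G] maps each [A_t] into itself, since it preserves
    divisibility.

    Let [phi] be such an endomorphism, for instance multiplication by a fixed
    element in some ring on [G].  As [G] is generated by [A] and [d], there is an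
    integer [k] with [phi d - k d] in [A].  With [v_t = phi e_t - k e_t] in [A_t],
    where [e_t] is the basis element on which [d] has the coordinate
    [s_t / m_t], the component of [phi d - k d] at [t] is [(s_t / m_t) v_t], so
    [v_t] is divisible by [m_t] in [A_t], because [s_t] and [m_t] are coprime
    ([deviation_divisible]).  Hence [phi g - k g] is the sum of the elements
    [r_t (v_t / m_t)] and of multiples of elements of the [A_t] by the
    coefficients of [g] along [C] ([endomorphism_generator]).  So the sum of the
    subgroup generated by [g] and of the [l_t A_t] is an absolute ideal
    ([absolute_ideal_sum]), [l_t] being a common divisor of the coefficients.

    Conversely, for [w] in [A_t] the map that sends a pair to [m_t^2] times the
    product of the two coordinates at [e_t] times [w] is a multiplication on
    [G].  It sends [(g, d)] to [r_t s_t w] and [(g, e_t)] to [r_t m_t w], so that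
    an absolute ideal containing [g] contains [r_t w]; coordinates along [C]
    are treated in the same way, with [1] for [m_t] ([absolute_ideal_contains]).
    Finally [l_t A_t] is generated by the multiples of [A_t] by the coefficients
    of [g], by the Bezout identity ([ell_sub]). *)

(** * Subgroups *)

Section Subgroups.
Variable V : vectType rat.
Implicit Types (G H K : set V) (x y : V).

Lemma subgroup0 H : subgroup H -> H 0.
Proof. by case. Qed.

Lemma subgroupB H x y : subgroup H -> H x -> H y -> H (x - y).
Proof. by case=> _; apply. Qed.

Lemma subgroupN H x : subgroup H -> H x -> H (- x).
Proof. by move=> sH Hx; rewrite -sub0r; apply: subgroupB => //; case: sH. Qed.

Lemma subgroupD H x y : subgroup H -> H x -> H y -> H (x + y).
Proof.
by move=> sH Hx Hy; rewrite -[y]opprK; apply: subgroupB => //; apply: subgroupN.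
Qed.

Lemma subgroupMn H x n : subgroup H -> H x -> H (x *+ n).
Proof.
move=> sH Hx; elim: n => [|n IHn]; first by rewrite mulr0n; apply: subgroup0.
by rewrite mulrS; apply: subgroupD.
Qed.

Lemma subgroupMz H x z : subgroup H -> H x -> H (x *~ z).
Proof.
move=> sH Hx; case: z => n; first by rewrite -pmulrn; apply: subgroupMn.
by rewrite NegzE mulrNz; apply: subgroupN => //; rewrite -pmulrn; apply: subgroupMn.
Qed.

Lemma subgroup_sum H (I : Type) (s : seq I) (P : pred I) (x : I -> V) :
  subgroup H -> (forall i, P i -> H (x i)) -> H (\sum_(i <- s | P i) x i).
Proof.
move=> sH Hx; apply: big_ind => //; first exact: subgroup0.
by move=> y z; apply: subgroupD.
Qed.

Lemma subgroup_fsum H (I : choiceType) (D : set I) (x : I -> V) :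
  subgroup H -> (forall i, D i -> H (x i)) -> H (\sum_(i \in D) x i).
Proof.
move=> sH Hx; case: finite_supportP => [|X XD _ _]; rewrite ?big_nil.
  by move=> *; exact: subgroup0.
by rewrite big_seq; apply: subgroup_sum => // i /XD/Hx.
Qed.

Lemma subgroup_addset H K : subgroup H -> subgroup K -> subgroup (addset H K).
Proof.
move=> sH sK; split.
  by exists 0; [apply: subgroup0|exists 0; [apply: subgroup0|rewrite addr0]].
move=> _ _ [x Hx [y Ky <-]] [x' Hx' [y' Ky' <-]].
exists (x - x'); first exact: subgroupB.
by exists (y - y'); [apply: subgroupB|rewrite opprD addrACA].
Qed.

Lemma addset_sub H K X : subgroup X -> H `<=` X -> K `<=` X -> addset H K `<=` X.
Proof. by move=> sX HX KX _ [x /HX Xx [y /KX Xy <-]]; apply: subgroupD. Qed.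

Lemma fsumB (I : choiceType) (D : set I) (x y : I -> V) : finite_set D ->
  \sum_(i \in D) (x i - y i) = \sum_(i \in D) x i - \sum_(i \in D) y i.
Proof. by move=> fD; rewrite !fsbig_finite// sumrB. Qed.

Lemma subgroup_sumset (I : choiceType) (D : set I) (X : I -> set V) :
  finite_set D -> (forall i, D i -> subgroup (X i)) -> subgroup (sumset D X).
Proof.
move=> fD sX; split.
  exists (fun=> 0); first by move=> i Di; apply: subgroup0; apply: sX.
  by rewrite fsbig1.
move=> _ _ [x Xx ->] [y Xy ->]; exists (fun i => x i - y i).
  by move=> i Di; apply: subgroupB; [apply: sX|apply: Xx|apply: Xy].
by rewrite fsumB.
Qed.

Lemma sumset_sub (I : choiceType) (D : set I) (X : I -> set V) H :
  subgroup H -> (forall i, D i -> X i `<=` H) -> sumset D X `<=` H.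
Proof.
by move=> sH XH _ [x Xx ->]; apply: subgroup_fsum => // i Di; apply/XH/Xx.
Qed.

Lemma sub_sumset (I : choiceType) (D : set I) (X : I -> set V) i :
  (forall j, D j -> X j 0) -> D i -> X i `<=` sumset D X.
Proof.
move=> X0 Di x Xx; exists (fun j => if j == i then x else 0).
  by move=> j Dj; case: eqP => [->|_] //; apply: X0.
rewrite (fsbigE [:: i])//; first by rewrite big_mkcond big_seq1 mem_set// eqxx.
  by move=> j /=; rewrite inE => /eqP ->.
by move=> j _; rewrite inE => /negPf ->.
Qed.

Lemma subgroup_scaleset (q : rat) H : subgroup H -> subgroup (scaleset q H).
Proof.
move=> sH; split; first by exists 0; [apply: subgroup0|rewrite scaler0].
move=> _ _ [x Hx <-] [y Hy <-].
by exists (x - y); [apply: subgroupB|rewrite scalerBr].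
Qed.

Lemma subgroup_gen (S : set V) : subgroup (gen S).
Proof.
split=> [H [sH _]|x y gx gy H HS]; first exact: subgroup0.
by apply: subgroupB; [case: HS|apply: gx|apply: gy].
Qed.

Lemma gen1P x y : gen [set x] y <-> exists z : int, y = x *~ z.
Proof.
split=> [|[z ->]]; last first.
  by move=> H [sH xH]; apply: subgroupMz => //; apply: xH.
move=> /(_ [set y | exists z : int, y = x *~ z]); apply; split=> [|_ ->]; last first.
  by exists 1; rewrite mulr1z.
split; first by exists 0; rewrite mulr0z.
by move=> _ _ [z ->] [w ->]; exists (z - w); rewrite mulrzBr.
Qed.

Lemma mulrn_inj x y n : (0 < n)%N -> x *+ n = y *+ n -> x = y.
Proof.
move=> n0 /eqP; rewrite -!scaler_nat -subr_eq0 -scalerBr scaler_eq0 subr_eq0.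
by rewrite pnatr_eq0 -leqn0 leqNgt n0 /= => /eqP.
Qed.

Lemma mulrn_eq0 x n : (0 < n)%N -> x *+ n = 0 -> x = 0.
Proof. by move=> n0 xn; apply: (mulrn_inj n0); rewrite mul0rn. Qed.

Lemma mulrz_eq0 x (z : int) : z != 0 -> x *~ z = 0 -> x = 0.
Proof.
move=> z0 /eqP; rewrite -scaler_int scaler_eq0 intr_eq0 (negPf z0) /=.
by move=> /eqP.
Qed.

Lemma mulrn_absz x (z : int) : x *+ `|z| = x *~ z *~ sgz z.
Proof. by rewrite -mulrzA mulrC -abszEsg pmulrn. Qed.

Lemma subgroup_absz H x (z : int) : subgroup H -> H (x *~ z) -> H (x *+ `|z|).
Proof. by move=> sH Hx; rewrite mulrn_absz; apply: subgroupMz. Qed.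

End Subgroups.

(** * Types *)

Lemma type_of_char_eq (c1 c2 : charac) :
  type_of_char c1 = type_of_char c2 <-> charac_equiv c1 c2.
Proof.
split=> [/(eqmodP charac_equiv_rel)/asboolP //|c12].
by apply/(eqmodP charac_equiv_rel)/asboolP.
Qed.

Lemma entry_le_anti (u v : option nat) : entry_le u v -> entry_le v u -> u = v.
Proof.
case: u v => [m|] [n|] //= mn nm; congr Some.
by apply/eqP; rewrite eqn_leq mn nm.
Qed.

Lemma type_le_anti (s t : gtype) : type_le s t -> type_le t s -> s = t.
Proof.
move=> [c1 [c2 [c1s c2t c12]]] [c3 [c4 [c3t c4s c34]]].
have /type_of_char_eq[f14 n14] : type_of_char c1 = type_of_char c4 by rewrite c1s.
have /type_of_char_eq[f23 n23] : type_of_char c2 = type_of_char c3 by rewrite c2t.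
rewrite -c1s -c2t; apply/type_of_char_eq; split=> [|p].
  apply: (@sub_finite_set _ _ ([set p | c1 p <> c4 p] `|` [set p | c2 p <> c3 p])).
    move=> p /= ne; apply: contrapT => /not_orP[/contrapT e14 /contrapT e23].
    by apply: ne; apply: entry_le_anti => //; rewrite e14 e23.
  by rewrite finite_setU.
have := c12 p; have := c34 p; have := n14 p; have := n23 p.
by case: (c1 p) (c2 p) (c3 p) (c4 p) => [?|] [?|] [?|] [?|] /=; intuition congruence.
Qed.

Lemma Pinf_char (c : charac) p : Pinf (type_of_char c) p -> c p = None.
Proof. by case=> c' [/type_of_char_eq[_ /(_ p)<-]]. Qed.

Lemma idempotent_Pinf (c : charac) p :
  idempotent_type (type_of_char c) -> c p = None -> Pinf (type_of_char c) p.
Proof.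
case=> c' c'c z cp; exists c'; split=> //.
by have /type_of_char_eq[_ ->] := c'c.
Qed.

(** What incomparability means for idempotent types, in terms of divisibility
    alone. *)
Definition separated (T : set gtype) : Prop :=
  forall t u, T t -> T u -> t <> u -> exists p, Pinf t p /\ ~ Pinf u p.

(** Inclusion between the sets of infinite entries is the order of types, since
    the remaining entries of the chosen representatives vanish. *)
Lemma incomparable_separated (T : set gtype) :
  (forall t, T t -> idempotent_type t) ->
  (forall s t, T s -> T t -> s <> t -> ~ type_le s t) -> separated T.
Proof.
move=> idT incT t u Tt Tu tu; apply: contrapT => /forallNP np.
apply: (incT t u Tt Tu tu).
have [c ct zc] := idT t Tt; have [c' cu zc'] := idT u Tu.
exists c, c'; split=> // p; have := np p; rewrite -ct -cu => npp.
case: (zc p) => [->|cp]; first by case: (c' p).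
suff -> : c' p = None by case: (c p).
apply: Pinf_char; apply: contrapT => nPu; apply: npp; split=> //.
by apply: idempotent_Pinf cp; rewrite ct; apply: idT.
Qed.

(** * Divisibility and heights *)

Section Heights.
Variable V : vectType rat.
Implicit Types (G H K : set V) (x y : V) (p : primeT).

Definition inf_div H x p : Prop := forall k, divides_in H x (val p ^ k)%N.

Lemma divides_in_mulz H x z n :
  subgroup H -> divides_in H x n -> divides_in H (x *~ z) n.
Proof.
move=> sH [y Hy ->]; exists (y *~ z); first exact: subgroupMz.
by rewrite !pmulrn mulrzAC.
Qed.

Lemma divides_in_coprime H x (z : int) n : subgroup H -> H x ->
  coprimez z n%:Z -> divides_in H (x *~ z) n -> divides_in H x n.
Proof.
move=> sH Hx /coprimezP[[u v] /= uv] [y Hy xy].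
exists (y *~ u + x *~ v).
  by apply: subgroupD => //; apply: subgroupMz.
rewrite -[LHS]mulr1z -uv mulrzDr [u * z]mulrC !mulrzA xy mulrnDl !pmulrn.
by rewrite [y *~ n *~ u]mulrzAC.
Qed.

Lemma prime_coprimez p (z : int) k :
  ~~ (val p %| `|z|)%N -> coprimez z (val p ^ k)%N%:Z.
Proof.
move=> pz; rewrite coprimezE /= coprime_sym; apply: coprimeXl.
by rewrite prime_coprime //; apply: valP.
Qed.

Lemma inf_div_mulz H x (z : int) p : subgroup H -> H x -> z != 0 ->
  inf_div H (x *~ z) p -> inf_div H x p.
Proof.
move=> sH Hx z0 dx k; have z0' : (0 < `|z|)%N by rewrite absz_gt0.
have [m pm zm] := pfactor_coprime (valP p) z0'.
have pm' : ~~ (val p %| `|m%:Z|)%N by rewrite -prime_coprime //; apply: valP.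
apply: (divides_in_coprime sH Hx (prime_coprimez k pm')).
have [y Hy xy] := dx (logn (val p) `|z| + k)%N.
have pos : (0 < val p ^ logn (val p) `|z|)%N by rewrite expn_gt0 prime_gt0 //; apply: valP.
exists (y *~ sgz z); first exact: subgroupMz.
apply: (mulrn_inj pos); rewrite -pmulrn -mulrnA -zm.
rewrite mulrn_absz xy expnD mulnC mulrnA !pmulrn.
by rewrite [LHS]mulrzAC [y *~ _ *~ sgz z]mulrzAC.
Qed.

Lemma subgroup_inf_div H p :
  subgroup H -> subgroup [set x | H x /\ inf_div H x p].
Proof.
move=> sH; split.
  by split=> [|k]; [|exists 0; [|rewrite mul0rn]]; rewrite //; apply: subgroup0.
move=> x y [Hx dx] [Hy dy]; split=> [|k]; first exact: subgroupB.
have [x' Hx' ->] := dx k; have [y' Hy' ->] := dy k.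
by exists (x' - y'); [apply: subgroupB|rewrite mulrnBl].
Qed.

Lemma inf_div_sub H K x p : H `<=` K -> inf_div H x p -> inf_div K x p.
Proof. by move=> HK dx k; have [y /HK Ky xy] := dx k; exists y. Qed.

Lemma divides_in_morph H K (f : V -> V) x n : subgroup H ->
  (forall x, H x -> K (f x)) ->
  (forall x y, H x -> H y -> f (x + y) = f x + f y) ->
  divides_in H x n -> divides_in K (f x) n.
Proof.
move=> sH HK fD [y Hy ->]; exists (f y); first exact: HK.
have f0 : f 0 = 0.
  have H0 := subgroup0 sH; apply: (addrI (f 0)); by rewrite -fD // !addr0.
elim: n => [|n IHn]; first by rewrite !mulr0n.
by rewrite !mulrS fD ?IHn //; apply: subgroupMn.
Qed.

Lemma height_None H x p : height H x p = None <-> inf_div H x p.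
Proof. by rewrite /height; case: asboolP => [h|h]; split. Qed.

Lemma height_Some H x p : H x -> ~ inf_div H x p ->
  exists h, [/\ height H x p = Some h, divides_in H x (val p ^ h)%N
              & ~ divides_in H x (val p ^ h.+1)%N].
Proof.
move=> Hx nd; rewrite /height; case: asboolP => // _.
set P := [set k | _]; suff /(xgetPex 0%N)[Pd Pn] : exists k, P k.
  by exists (xget 0%N P).
apply: contrapT => /forallNP nP; apply: nd; elim=> [|k IHk].
  by exists x; rewrite ?expn0 ?mulr1n.
by apply: contrapT => nk; apply: (nP k).
Qed.

Lemma divides_in_exp H x (p : primeT) h k : subgroup H -> (h <= k)%N ->
  divides_in H x (val p ^ k)%N -> divides_in H x (val p ^ h)%N.
Proof.
move=> sH hk [y Hy ->]; exists (y *+ (val p ^ (k - h))).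
  exact: subgroupMn.
by rewrite -mulrnA -expnD subnK.
Qed.

Lemma height_le H K x y p : subgroup H -> subgroup K -> H x -> K y ->
  (forall k, divides_in H x (val p ^ k)%N -> divides_in K y (val p ^ k)%N) ->
  entry_le (height H x p) (height K y p).
Proof.
move=> sH sK Hx Ky HK; have [/height_None ->|nK] := pselect (inf_div K y p).
  by case: (height H x p).
have nH : ~ inf_div H x p by move=> h; apply: nK => k; apply/HK/h.
have [h [-> hd _]] := height_Some Hx nH; have [k [-> _ kn]] := height_Some Ky nK.
rewrite /= leqNgt; apply/negP => kh; apply: kn; apply: HK.
exact: divides_in_exp hd.
Qed.

Lemma finite_prime_divisors n :
  (0 < n)%N -> finite_set [set p : primeT | (val p %| n)%N].
Proof.
move=> n0; have inj : {in (val : primeT -> nat) @^-1` `I_n.+1 &, injective val}.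
  by move=> p q _ _; apply: val_inj.
apply: sub_finite_set (finite_preimage inj (finite_II n.+1)).
by move=> p /= pn; rewrite ltnS dvdn_leq.
Qed.

(** The two heights can differ only at the primes that divide one of the two
    multipliers. *)
Lemma height_equiv H x y (m n : int) : subgroup H -> H x -> H y ->
  m != 0 -> n != 0 -> x *~ m = y *~ n ->
  charac_equiv (height H x) (height H y).
Proof.
move=> sH Hx Hy m0 n0 xy; split; last first.
  move=> p; split=> /height_None h; apply/height_None.
    by apply: (inf_div_mulz sH Hy n0) => k; rewrite -xy; apply: divides_in_mulz.
  by apply: (inf_div_mulz sH Hx m0) => k; rewrite xy; apply: divides_in_mulz.
have mn0 : (0 < `|m| * `|n|)%N by rewrite muln_gt0 !absz_gt0 m0 n0.
apply: sub_finite_set (finite_prime_divisors mn0).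
move=> p /= ne; rewrite Euclid_dvdM ?(valP p) //; apply: contrapT.
move/negP; rewrite negb_or => /andP[pm pn]; apply: ne.
apply: entry_le_anti; apply: height_le => // k.
  move/(divides_in_mulz m sH); rewrite xy.
  exact: divides_in_coprime (prime_coprimez _ _).
move/(divides_in_mulz n sH); rewrite -xy.
exact: divides_in_coprime (prime_coprimez _ _).
Qed.

(** * Groups of rank one *)

Lemma rank1_subgroup H : rank1 H -> subgroup H.
Proof. by case. Qed.

Lemma rank1_commensurable H x y : rank1 H -> H x -> H y -> x != 0 ->
  exists m n : int, n != 0 /\ y *~ n = x *~ m.
Proof.
move=> [sH [z [Hz z0 Hzq]]] /Hzq[q ->] /Hzq[q' ->] qz0.
have q0 : q != 0 by apply: contraNneq qz0 => ->; rewrite scale0r.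
exists (numq (q' / q)), (denq (q' / q)); split; first exact: denq_neq0.
rewrite -!scaler_int !scalerA; congr (_ *: _).
by rewrite numqE mulrAC divfK // mulrC.
Qed.

Lemma type_of_height H x :
  rank1 H -> H x -> x != 0 -> type_of H = type_of_char (height H x).
Proof.
move=> rH Hx x0; rewrite /type_of; case: xgetP => [y -> [Hy y0]|/(_ x)[]//].
apply/type_of_char_eq.
have [m [n [n0 yx]]] := rank1_commensurable rH Hx Hy x0.
apply: (height_equiv (rank1_subgroup rH) Hy Hx n0 _ yx).
apply: contraNneq y0 => m0; rewrite m0 mulr0z in yx.
by apply/eqP/(mulrz_eq0 n0).
Qed.

Lemma rank1_neq0 H : rank1 H -> exists2 x, H x & x != 0.
Proof. by case=> _ [x [Hx x0 _]]; exists x. Qed.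

Lemma type_le_morph H K (f : V -> V) x : rank1 H -> rank1 K ->
  (forall x, H x -> K (f x)) ->
  (forall x y, H x -> H y -> f (x + y) = f x + f y) ->
  H x -> x != 0 -> f x != 0 -> type_le (type_of H) (type_of K).
Proof.
move=> rH rK HK fD Hx x0 fx0.
rewrite (type_of_height rH Hx x0) (type_of_height rK (HK x Hx) fx0).
do 2!eexists; split; [reflexivity|reflexivity|move=> p].
apply: height_le => //; [exact: rank1_subgroup|exact: rank1_subgroup|exact: HK|].
by move=> k; apply: divides_in_morph => //; apply: rank1_subgroup.
Qed.

Lemma rank1_Pinf H p x : rank1 H -> Pinf (type_of H) p -> H x -> inf_div H x p.
Proof.
move=> rH Pp Hx; have [->|x0] := eqVneq x 0.
  move=> k; exists 0; last by rewrite mul0rn.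
  exact: subgroup0 (rank1_subgroup rH).
apply/height_None/Pinf_char; by rewrite -type_of_height.
Qed.

Lemma rank1_nPinf H p x : rank1 H -> idempotent_type (type_of H) ->
  ~ Pinf (type_of H) p -> H x -> inf_div H x p -> x = 0.
Proof.
move=> rH iH nP Hx dx; apply: contrapT => /eqP x0; apply: nP.
rewrite (type_of_height rH Hx x0) in iH *.
by apply: idempotent_Pinf => //; apply/height_None.
Qed.

End Heights.

(** * Completely decomposable groups *)

Section Decompositions.
Variable V : vectType rat.
Implicit Types (A H K : set V) (x y : V) (p : primeT) (t : gtype).

Lemma fsum_ord n (D : set 'I_n) (F : 'I_n -> V) :
  \sum_(i \in D) F i = \sum_i (if i \in D then F i else 0).
Proof.
rewrite fsbig_mkcond [RHS](bigfs _ (index_enum_uniq _)) ?mem_index_enum //.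
  by apply: eq_fsbigl; apply/seteqP; split.
by move=> i _; rewrite mem_index_enum.
Qed.

Lemma fsum_ordT n (F : 'I_n -> V) : \sum_(i \in [set: 'I_n]) F i = \sum_i F i.
Proof. by rewrite fsum_ord; apply: eq_bigr => i _; rewrite in_setT. Qed.

Lemma cd_rank1 A n (X : 'I_n -> set V) i : cd_decomp A X -> rank1 (X i).
Proof. by case. Qed.

Lemma cd_subgroup A n (X : 'I_n -> set V) : cd_decomp A X -> subgroup A.
Proof.
move=> [rX _ ->]; apply: subgroup_sumset => [|i _]; first exact: finite_finset.
exact/rank1_subgroup/rX.
Qed.

Lemma cd_sub A n (X : 'I_n -> set V) i : cd_decomp A X -> X i `<=` A.
Proof.
move=> [rX _ ->]; apply: sub_sumset => // j _.
exact: subgroup0 (rank1_subgroup (rX j)).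
Qed.

Definition components A n (X : 'I_n -> set V) (c : 'I_n -> V -> V) : Prop :=
  [/\ forall x i, A x -> X i (c i x), forall x, A x -> x = \sum_i c i x
    & forall y : 'I_n -> V, (forall i, X i (y i)) ->
        forall i, c i (\sum_j y j) = y i].

Lemma components_exist A n (X : 'I_n -> set V) :
  cd_decomp A X -> exists c, components A X c.
Proof.
move=> cX; have [rX indX AX] := cX.
have /choice[c cP] : forall x, exists y : 'I_n -> V,
    A x -> (forall i, X i (y i)) /\ x = \sum_i y i.
  move=> x; have [|nA] := pselect (A x); last by exists (fun=> 0).
  rewrite {1}AX => -[y Xy ->]; exists y; rewrite fsum_ordT; split=> // i.
  exact: Xy.
exists (fun i x => c x i); split=> [x i Ax|x Ax|y Xy i].
- by have [] := cP x Ax.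
- by have [] := cP x Ax.
have Ay : A (\sum_j y j) by rewrite AX -fsum_ordT; exists y.
have [Xc sc] := cP _ Ay; apply/eqP; rewrite -subr_eq0; apply/eqP.
apply: (indX (fun i => c (\sum_j y j) i - y i)) => //.
  by move=> j _; apply: subgroupB => //; apply/rank1_subgroup/rX.
by rewrite fsumB; [rewrite !fsum_ordT -sc subrr|exact: finite_finset].
Qed.

Section Components.
Variables (A : set V) (n : nat) (X : 'I_n -> set V) (c : 'I_n -> V -> V).
Hypotheses (cX : cd_decomp A X) (cc : components A X c).

Lemma component_in x i : A x -> X i (c i x).
Proof. by case: cc => h _ _; apply: h. Qed.

Lemma component_sum x : A x -> x = \sum_i c i x.
Proof. by case: cc => _ h _; apply: h. Qed.

Lemma componentD i x y : A x -> A y -> c i (x + y) = c i x + c i y.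
Proof.
case: cc => Xc sc uc Ax Ay; rewrite {1}(sc x Ax) {1}(sc y Ay) -big_split /=.
apply: (uc (fun i => c i x + c i y)) => j.
by apply: subgroupD; [exact: rank1_subgroup (cd_rank1 j cX)|exact: Xc|exact: Xc].
Qed.

Lemma componentMz i x z : A x -> c i (x *~ z) = c i x *~ z.
Proof.
case: cc => Xc sc uc Ax; rewrite {1}(sc x Ax) mulrz_suml.
apply: (uc (fun i => c i x *~ z)) => j.
by apply: subgroupMz; [exact: rank1_subgroup (cd_rank1 j cX)|exact: Xc].
Qed.

Lemma componentMn i x k : A x -> c i (x *+ k) = c i x *+ k.
Proof. by rewrite !pmulrn; apply: componentMz. Qed.

Lemma component_id i j x : X i x -> c j x = if j == i then x else 0.
Proof.
case: cc => Xc sc uc Xx.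
rewrite -(uc (fun j => if j == i then x else 0)) //.
  by rewrite -big_mkcond big_pred1_eq.
move=> k; case: eqP => [->//|_].
exact: subgroup0 (rank1_subgroup (cd_rank1 k cX)).
Qed.

Lemma component_inf_div i x p : A x -> inf_div A x p -> inf_div (X i) (c i x) p.
Proof.
move=> Ax dx k; apply: divides_in_morph (dx k).
- exact: cd_subgroup cX.
- by move=> y; apply: component_in.
- exact: componentD.
Qed.

Lemma component0 i : c i 0 = 0.
Proof.
by rewrite (component_id i (subgroup0 (rank1_subgroup (cd_rank1 i cX)))) eqxx.
Qed.

End Components.

(** The set of types of the summands is an invariant of quasi-isomorphism: a
    summand of type [t] maps non-trivially to some summand of the other group,
    which maps non-trivially back to the given summand, so both have type [t]. *)
Lemma cd_types_sub A K n m (X : 'I_n -> set V) (Y : 'I_m -> set V) (a b : nat) :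
  cd_decomp A X -> cd_decomp K Y -> (0 < a)%N -> (0 < b)%N ->
  (forall x, A x -> K (x *+ a)) -> (forall y, K y -> A (y *+ b)) ->
  forall i, exists j, type_of (X i) = type_of (Y j).
Proof.
move=> cX cY a0 b0 AK KA i.
have [c cc] := components_exist cX; have [k kk] := components_exist cY.
have [x Xx x0] := rank1_neq0 (cd_rank1 i cX).
have Ax := cd_sub cX Xx; have Kx := AK x Ax.
have sA := cd_subgroup cX; have sK := cd_subgroup cY.
have [j kj0] : exists j, c i (k j (x *+ a) *+ b) != 0.
  apply: contrapT => /forallNP h; have : c i (x *+ a *+ b) == 0.
    rewrite {1}(component_sum kk Kx) -sumrMnl.
    have cD := componentD cX cc i.
    have c0 := component0 cX cc i.
    pose P y := A y /\ c i y = 0.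
    suff [_ ->] : P (\sum_j k j (x *+ a) *+ b) by [].
    apply: (big_ind P) => [|y z [Ay cy] [Az cz]|j _].
    - by split=> //; apply: subgroup0.
    - by split; [apply: subgroupD|rewrite cD // cy cz addr0].
    split; last by apply/eqP; apply: contrapT => /negP; apply: h.
    exact: KA (cd_sub cY (component_in kk j Kx)).
  rewrite -mulrnA (componentMn cX cc) // (component_id cX cc _ Xx) eqxx.
  move/eqP/(mulrn_eq0 _) => x0'; move: x0.
  by rewrite x0' ?eqxx // muln_gt0 a0 b0.
exists j; have Yk := component_in kk j Kx; have Kk := cd_sub cY Yk.
have k0 : k j (x *+ a) != 0.
  apply: contraNneq kj0 => ->; by rewrite mul0rn (component0 cX cc) eqxx.
apply: type_le_anti.
- apply: (@type_le_morph _ _ _ (fun y => k j (y *+ a)) x) => //.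
  + exact: cd_rank1 cX.
  + exact: cd_rank1 cY.
  + by move=> y /(cd_sub cX)/AK Ky; exact: (component_in kk j Ky).
  + move=> y z /(cd_sub cX)/AK Ky /(cd_sub cX)/AK Kz.
    by rewrite mulrnDl (componentD cY kk).
apply: (@type_le_morph _ _ _ (fun y => c i (y *+ b)) (k j (x *+ a))) => //.
- exact: cd_rank1 cY.
- exact: cd_rank1 cX.
- by move=> y /(cd_sub cY)/KA Ky; exact: (component_in cc i Ky).
move=> y z /(cd_sub cY)/KA Ky /(cd_sub cY)/KA Kz.
by rewrite mulrnDl (componentD cX cc).
Qed.

Lemma homog_cd A t x : homog A t x -> completely_decomposable A.
Proof. by case=> n [X [cX _]]; exists n, X. Qed.

Lemma summand_homog A n (X : 'I_n -> set V) i :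
  cd_decomp A X -> X i `<=` homog A (type_of (X i)).
Proof.
move=> cX x Xx; exists n, X; split=> //; move: Xx; apply: sub_sumset => // j _.
exact: subgroup0 (rank1_subgroup (cd_rank1 j cX)).
Qed.

Lemma critP A n (X : 'I_n -> set V) t : cd_decomp A X ->
  crit A t <-> exists i, type_of (X i) = t.
Proof.
move=> cX; split=> [[x [m [Y [cY [y Yy ->]]]] x0]|[i <-]]; last first.
  have [x Xx x0] := rank1_neq0 (cd_rank1 i cX).
  by exists x => //; apply: summand_homog Xx.
have [j <-] : exists j, type_of (Y j) = t.
  apply: contrapT => /forallNP h; move/eqP: x0; apply.
  by apply: fsbig1 => j /h.
have [i ->] := cd_types_sub cY cX (ltn0Sn 0) (ltn0Sn 0)
  (fun _ h => h) (fun _ h => h) j.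
by exists i.
Qed.

Lemma finite_crit A : completely_decomposable A -> finite_set (crit A).
Proof.
move=> [n [X cX]].
have -> : crit A = (fun i => type_of (X i)) @` setT.
  by apply/seteqP; split=> t => [/(critP _ cX)[i <-]|[i _ <-]];
     [exists i|apply/(critP _ cX); exists i].
exact/finite_image/finite_finset.
Qed.

Lemma homog_inf_div A t x p : homog A t x -> Pinf t p -> inf_div A x p.
Proof.
move=> [n [X [cX [y Xy ->]]]] Pp; have sA := cd_subgroup cX.
suff [] : [set x | A x /\ inf_div A x p]
    (\sum_(i \in [set i | type_of (X i) = t]) y i) by [].
apply: subgroup_fsum => [|i /= ti]; first exact: subgroup_inf_div.
have Xyi := Xy i ti; split; first exact: cd_sub Xyi.
apply: inf_div_sub (rank1_Pinf (cd_rank1 i cX) _ Xyi); first exact: cd_sub.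
by rewrite ti.
Qed.

Lemma homog_sub A t : homog A t `<=` A.
Proof.
move=> x [n [X [cX [y Xy ->]]]]; apply: subgroup_fsum (cd_subgroup cX) _ => i ti.
exact: cd_sub (Xy i ti).
Qed.

Section Separated.
Variables (A : set V) (U : set gtype).
Hypotheses (cdA : completely_decomposable A) (AU : crit A `<=` U)
  (id_U : forall t, U t -> idempotent_type t) (sep_U : separated U).

(** Some prime is inverted in [t] but not in the type of the summand, and a
    group of rank one and idempotent type has no non-zero element infinitely
    divisible by a prime that is not inverted in its type. *)
Lemma component_eq0 n (X : 'I_n -> set V) c i t x :
  cd_decomp A X -> components A X c -> U t -> type_of (X i) <> t -> A x ->
  (forall p, Pinf t p -> inf_div A x p) -> c i x = 0.
Proof.
move=> cX cc Ut ti Ax dx; have Ui : U (type_of (X i)).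
  by apply/AU/(critP _ cX); exists i.
have [p [tp np]] := sep_U Ut Ui (nesym ti).
apply: (rank1_nPinf (cd_rank1 i cX) (id_U Ui) np).
  exact: (component_in cc i Ax).
exact: (component_inf_div cX cc i Ax (dx p tp)).
Qed.

Lemma inf_div_sumset n (X : 'I_n -> set V) t x : cd_decomp A X -> U t -> A x ->
  (forall p, Pinf t p -> inf_div A x p) ->
  sumset [set i | type_of (X i) = t] X x.
Proof.
move=> cX Ut Ax dx; have [c cc] := components_exist cX.
exists (c^~ x) => [i _|]; first exact: (component_in cc i Ax).
rewrite fsum_ord {1}(component_sum cc Ax); apply: eq_bigr => i _.
case: ifPn => // /negP ni; apply: (component_eq0 cX cc Ut _ Ax dx) => ti.
by apply: ni; rewrite inE.
Qed.

(** The homogeneous components have a description that mentions no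
    decomposition, which gives their invariance under endomorphisms and their
    behaviour in direct sums. *)
Lemma homogP t x : U t ->
  homog A t x <-> A x /\ forall p, Pinf t p -> inf_div A x p.
Proof.
move=> Ut; split=> [hx|[Ax dx]].
  by split=> [|p]; [exact: homog_sub hx|exact: homog_inf_div].
by have [n [X cX]] := cdA; exists n, X; split=> //; apply: inf_div_sumset.
Qed.

Lemma subgroup_homog t : U t -> subgroup (homog A t).
Proof.
move=> Ut; have [n [X /cd_subgroup sA]] := cdA.
split=> [|x y /(homogP _ Ut)[Ax dx] /(homogP _ Ut)[Ay dy]]; apply/(homogP _ Ut).
  split=> [|p _]; first exact: subgroup0.
  by case: (subgroup0 (subgroup_inf_div p sA)).
split=> [|p Pp]; first exact: subgroupB.
by case: (subgroupB (subgroup_inf_div p sA) (conj Ax (dx p Pp)) (conj Ay (dy p Pp))).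
Qed.

Lemma homog_ncrit t x : U t -> ~ crit A t -> homog A t x -> x = 0.
Proof.
by move=> Ut nAt hx; apply: contrapT => /eqP x0; apply: nAt; exists x.
Qed.

Lemma sumset_homog : A = sumset (crit A) (homog A).
Proof.
have [n [X cX]] := cdA; have fA := finite_crit cdA.
have sA := cd_subgroup cX.
apply/seteqP; split; last by apply: sumset_sub => // t _; apply: homog_sub.
have [c cc] := components_exist cX; move=> x Ax; rewrite (component_sum cc Ax).
have sH t : crit A t -> subgroup (homog A t) by move=> /AU; apply: subgroup_homog.
apply: subgroup_sum; first exact: subgroup_sumset.
move=> i _; apply: (@sub_sumset _ _ _ _ (type_of (X i))).
- by move=> t /sH /subgroup0.
- by apply/(critP _ cX); exists i.
- exact: summand_homog cX _ (component_in cc i Ax).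
Qed.

Lemma independent_homog : independent (crit A) (homog A).
Proof.
move=> x Hx sx t At; have [n [X cX]] := cdA; have Ut := AU At.
have [c cc] := components_exist cX; have sA := cd_subgroup cX.
have fA := finite_crit cdA.
have [Axt dx] := (homogP _ Ut).1 (Hx t At).
rewrite (component_sum cc Axt); apply: big1 => i _.
have [ti|ti] := pselect (type_of (X i) = t); last exact: (component_eq0 cX cc Ut ti).
have c0 := component0 cX cc i.
rewrite -[RHS]c0 -sx (fsbigD1 t) // (componentD cX cc) //; last first.
  by apply: subgroup_fsum => // u [Au _]; apply: homog_sub (Hx u Au).
rewrite [X in _ + X](_ : _ = 0) ?addr0 //.
suff [] : [set y | A y /\ c i y = 0] (\sum_(u \in crit A `\ t) x u) by [].
apply: subgroup_fsum => [|u [Au /= ut]].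
  split=> [|y z [Ay cy] [Az cz]]; first by split=> //; apply: subgroup0.
  have Az' := subgroupN sA Az; split; first exact: subgroupD.
  by rewrite (componentD cX cc) // cy -mulrN1z (componentMz cX cc) // cz mul0rz addr0.
have [Axu du] := (homogP _ (AU Au)).1 (Hx u Au); split=> //.
by apply: (component_eq0 cX cc (AU Au) _ Axu du); rewrite ti; apply: nesym.
Qed.

End Separated.

Lemma crit_quasi A K (a b : nat) :
  completely_decomposable A -> completely_decomposable K ->
  (0 < a)%N -> (0 < b)%N ->
  (forall x, A x -> K (x *+ a)) -> (forall y, K y -> A (y *+ b)) ->
  crit A = crit K.
Proof.
move=> [n [X cX]] [m [Y cY]] a0 b0 AK KA; apply/seteqP; split=> t.
  move=> /(critP _ cX)[i <-]; apply/(critP _ cY).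
  by have [j ->] := cd_types_sub cX cY a0 b0 AK KA i; exists j.
move=> /(critP _ cY)[i <-]; apply/(critP _ cX).
by have [j ->] := cd_types_sub cY cX b0 a0 KA AK i; exists j.
Qed.

Lemma summand_pure A n (X : 'I_n -> set V) i x k : cd_decomp A X -> (0 < k)%N ->
  A x -> X i (x *+ k) -> X i x.
Proof.
move=> cX k0 Ax Xk; have [c cc] := components_exist cX.
suff -> : x = c i x by exact: (component_in cc i Ax).
rewrite {1}(component_sum cc Ax) (bigD1 i) //= big1 ?addr0 // => j ji.
apply: (mulrn_eq0 k0); rewrite -(componentMn cX cc) //.
by rewrite (component_id cX cc _ Xk) (negPf ji).
Qed.

Lemma cd_addset A K n m (X : 'I_n -> set V) (Y : 'I_m -> set V) :
  cd_decomp A X -> cd_decomp K Y -> A `&` K = [set 0] ->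
  cd_decomp (addset A K)
    (fun k => match fintype.split k with inl i => X i | inr j => Y j end).
Proof.
move=> cX cY AK0; have [rX iX AX] := cX; have [rY iY KY] := cY.
have sA := cd_subgroup cX; have sK := cd_subgroup cY.
set Z := fun k : 'I_(n + m) => _.
have ZX (z : 'I_(n + m) -> V) : (forall k, [set: 'I_(n + m)] k -> Z k (z k)) ->
    forall i, X i (z (lshift m i)).
  by move=> Zz i; have := Zz (lshift m i) I; rewrite /Z (unsplitK (inl i)).
have ZY (z : 'I_(n + m) -> V) : (forall k, [set: 'I_(n + m)] k -> Z k (z k)) ->
    forall i, Y i (z (rshift n i)).
  by move=> Zz i; have := Zz (rshift n i) I; rewrite /Z (unsplitK (inr i)).
split.
- by move=> k; rewrite /Z; case: fintype.split.
- move=> z Zz; rewrite fsum_ordT big_split_ord /= => sz k _.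
  have Ax : A (\sum_i z (lshift m i)).
    by rewrite AX -fsum_ordT; exists (fun i => z (lshift m i)) => // i _; apply: ZX.
  have Ky : K (\sum_i z (rshift n i)).
    by rewrite KY -fsum_ordT; exists (fun i => z (rshift n i)) => // i _; apply: ZY.
  have x0 : \sum_i z (lshift m i) = 0.
    have : (A `&` K) (\sum_i z (lshift m i)).
      split=> //; have -> : \sum_i z (lshift m i) = - \sum_i z (rshift n i).
        by apply/eqP; rewrite -addr_eq0 sz.
      exact: subgroupN.
    by rewrite AK0.
  have y0 : \sum_i z (rshift n i) = 0 by move: sz; rewrite x0 add0r.
  rewrite -[k]splitK; case: (fintype.split k) => i /=.
    by apply: (iX (fun i => z (lshift m i))); rewrite ?fsum_ordT // => j _; apply: ZX.
  by apply: (iY (fun i => z (rshift n i))); rewrite ?fsum_ordT // => j _; apply: ZY.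
apply/seteqP; split=> [_ [x Ax [y Ky <-]]|_ [z Zz ->]].
  move: Ax Ky; rewrite AX KY => -[x' Xx' ->] [y' Yy' ->].
  exists (fun k => match fintype.split k with inl i => x' i | inr j => y' j end).
    by move=> k _; rewrite /Z; case: fintype.split => i; [apply: Xx'|apply: Yy'].
  rewrite !fsum_ordT big_split_ord /=; congr (_ + _); apply: eq_bigr => i _.
    by rewrite (unsplitK (inl i)).
  by rewrite (unsplitK (inr i)).
rewrite fsum_ordT big_split_ord /=; exists (\sum_i z (lshift m i)).
  by rewrite AX -fsum_ordT; exists (fun i => z (lshift m i)) => // i _; apply: ZX.
exists (\sum_i z (rshift n i)) => //.
by rewrite KY -fsum_ordT; exists (fun i => z (rshift n i)) => // i _; apply: ZY.
Qed.

Lemma crit_addset A K : completely_decomposable A -> completely_decomposable K ->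
  A `&` K = [set 0] -> crit (addset A K) = crit A `|` crit K.
Proof.
move=> [n [X cX]] [m [Y cY]] AK0; have cZ := cd_addset cX cY AK0.
apply/seteqP; split=> t.
  move/(critP _ cZ) => [k]; case: (fintype.split k) => i <-.
    by left; apply/(critP _ cX); exists i.
  by right; apply/(critP _ cY); exists i.
case=> [/(critP _ cX)|/(critP _ cY)] [i <-]; apply/(critP _ cZ).
  by exists (lshift m i); rewrite (unsplitK (inl i)).
by exists (rshift n i); rewrite (unsplitK (inr i)).
Qed.

End Decompositions.

(** * The regulator *)

Section Regulator.
Variable V : vectType rat.
Implicit Types (G H K Z : set V) (x y : V).

Lemma has_index_mulrn G H n x : subgroup G -> subgroup H ->
  has_index G H n -> G x -> H (x *+ n`!).
Proof.
move=> sG sH [c [Gc cP]] Gx.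
have /choice[f fP] : forall k : 'I_n.+1, exists i, H (x *+ k - c i).
  by move=> k; have [i [Hi _]] := cP _ (subgroupMn k sG Gx); exists i.
(* Two of the first [n.+1] multiples of [x] lie in the same coset. *)
have [k [j jk /= fjk]] : exists k, exists2 j, j != k & f j = f k.
  apply: contrapT => /forallNP nf; suff /leq_card : injective f.
    by rewrite !card_ord ltnn.
  move=> j k fjk; apply: contrapT => /eqP jk; by apply: (nf k); exists j.
have key (a b : 'I_n.+1) : (a < b)%N -> f a = f b -> H (x *+ n`!).
  move=> ab fab; have : H (x *+ (b - a)).
    rewrite mulrnBr ?(ltnW ab) // -(subrKA (c (f a))).
    have -> : x *+ b - c (f a) + (c (f a) - x *+ a)
            = (x *+ b - c (f b)) - (x *+ a - c (f a)) by rewrite fab opprB.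
    exact: subgroupB.
  have : (b - a %| n`!)%N.
    by rewrite dvdn_fact // subn_gt0 ab /= (leq_trans (leq_subr _ _)) // -ltnS.
  by move=> /dvdnP[q ->] Hx; rewrite mulnC mulrnA; apply: subgroupMn.
have [ab|ba|/val_inj ab] := ltngtP j k; [exact: key fjk|exact: key (esym fjk)|].
by rewrite ab eqxx in jk.
Qed.

(** Each coset of [Z] keeps its first representative among those of the cosets
    of [H]; when the indices agree nothing was discarded, so distinct cosets of
    [H] lie in distinct cosets of [Z]. *)
Lemma has_index_between G H Z n : subgroup G -> subgroup H -> subgroup Z ->
  H `<=` Z -> Z `<=` G -> has_index G H n ->
  exists m, [/\ (m <= n)%N, has_index G Z m & m = n -> Z `<=` H].
Proof.
move=> sG sH sZ HZ ZG [c [Gc cP]].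
pose P := [set i : 'I_n | [forall j : 'I_n, (j < i)%N ==> ~~ `[< Z (c i - c j) >]]]%SET.
have PP i : i \in P <-> forall j : 'I_n, (j < i)%N -> ~ Z (c i - c j).
  rewrite inE; split=> [/forallP h j ji|h].
    by have /implyP/(_ ji)/asboolP := h j.
  by apply/forallP => j; apply/implyP => ji; apply/asboolP/h.
have uniqP i j : i \in P -> j \in P -> Z (c i - c j) -> i = j.
  move=> /PP Pi /PP Pj Zij; have [ij|ji|/val_inj//] := ltngtP i j.
    by case: (Pj i ij); rewrite -opprB; apply: subgroupN.
  by case: (Pi j ji).
have repP g : G g -> exists2 i, i \in P & Z (g - c i).
  move=> Gg; have [i [/HZ Zi _]] := cP g Gg.
  have ex : exists k, `[< exists2 i : 'I_n, val i = k & Z (g - c i) >].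
    by exists i; apply/asboolP; exists i.
  case: (ex_minnP ex) => k /asboolP[j jk Zj] kmin; exists j => //.
  apply/PP => l lj Zjl; have : (k <= l)%N.
    apply: kmin; apply/asboolP; exists l => //.
    by rewrite -(subrKA (c j)); apply: subgroupD.
  by rewrite leqNgt -jk lj.
exists #|P|; split.
- by rewrite -[n in (_ <= n)%N]card_ord; apply: max_card.
- exists (fun k => c (enum_val k)); split=> [k|g Gg]; first exact: Gc.
  have [i Pi Zi] := repP g Gg; exists (enum_rank_in Pi i).
  split=> [|k Zk]; first by rewrite enum_rankK_in.
  apply: enum_val_inj; rewrite enum_rankK_in //; apply: uniqP => //.
    exact: enum_valP.
  have -> : c i - c (enum_val k) = (g - c (enum_val k)) - (g - c i).
    by rewrite opprB [X in _ = X]addrC addrA subrK.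
  exact: subgroupB.
move=> Pn z Zz; have PT i : i \in P.
  suff -> : P = [set: 'I_n]%SET by rewrite inE.
  by apply/eqP; rewrite eqEcard finset.subsetT cardsT card_ord Pn leqnn.
have [i [Hi _]] := cP z (ZG z Zz); have [j [Hj _]] := cP 0 (subgroup0 sG).
have ij : i = j.
  apply: uniqP => //.
  have -> : c i - c j = z - (z - c i) + (0 - c j) by rewrite subKr sub0r.
  by apply: (subgroupD sZ); [apply: (subgroupB sZ) => //; apply: HZ|apply: HZ].
have -> : z = (z - c i) - (0 - c j) by rewrite ij sub0r opprK subrK.
exact: subgroupB.
Qed.

Lemma completely_decomposable_subgroup Z : completely_decomposable Z -> subgroup Z.
Proof. by move=> [n [X /cd_subgroup]]. Qed.

Lemma regulating_exists G : ACD G -> exists Z, regulating G Z.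
Proof.
move=> [sG [A [n [cA AG iA]]]].
have ex : exists k, `[< exists K,
    [/\ completely_decomposable K, K `<=` G & has_index G K k] >].
  by exists n; apply/asboolP; exists A.
case: (ex_minnP ex) => k /asboolP[Z [cZ ZG iZ]] kmin; exists Z; split=> //.
by exists k => // K l cK KG iK; apply: kmin; apply/asboolP; exists K.
Qed.

Lemma Reg_subgroup G : subgroup (Reg G).
Proof.
split=> [H [/completely_decomposable_subgroup sH _ _]|]; first exact: subgroup0.
move=> x y Rx Ry H rH; have [/completely_decomposable_subgroup sH _ _] := rH.
by apply: subgroupB => //; [apply: Rx|apply: Ry].
Qed.

Lemma Reg_sub G : ACD G -> Reg G `<=` G.
Proof. by move=> /regulating_exists[Z rZ] x /(_ Z rZ); case: rZ => _ ZG _ /ZG. Qed.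

(** All regulating subgroups have the same index, so one multiplier serves them
    all. *)
Lemma Reg_bounded G : ACD G ->
  exists2 N, (0 < N)%N & forall x, G x -> Reg G (x *+ N).
Proof.
move=> aG; have [sG _] := aG; have [Z [cZ ZG [n iZ nmin]]] := regulating_exists aG.
exists n`!; first exact: fact_gt0.
move=> x Gx H [cH HG [k iH kmin]].
have -> : n = k.
  by apply/eqP; rewrite eqn_leq (nmin _ _ cH HG iH) (kmin _ _ cZ ZG iZ).
exact: has_index_mulrn (completely_decomposable_subgroup cH) iH Gx.
Qed.

(** A regulating subgroup lies in [Z], and minimality of its index leaves no room
    for it to be smaller; so [Z] is the only one. *)
Lemma Reg_greatest G Z : ACD G -> completely_decomposable Z -> Z `<=` G ->
  (forall K k, completely_decomposable K -> K `<=` G -> has_index G K k ->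
     K `<=` Z) -> Reg G = Z.
Proof.
move=> aG cZ ZG max; have sZ := completely_decomposable_subgroup cZ.
have [sG [A [n [cA AG iA]]]] := aG.
have cmp K k : completely_decomposable K -> K `<=` G -> has_index G K k ->
    exists m, [/\ (m <= k)%N, has_index G Z m & m = k -> Z `<=` K].
  move=> cK KG iK; apply: (has_index_between _ _ _ _ _ iK) => //.
    exact: completely_decomposable_subgroup.
  exact: max iK.
have regZ H : regulating G H -> H = Z.
  move=> [cH HG [k iH kmin]]; have [m [mk iZ mZ]] := cmp H k cH HG iH.
  apply/seteqP; split; first exact: max iH.
  by apply: mZ; apply/eqP; rewrite eqn_leq mk (kmin Z).
have [Y rY] := regulating_exists aG; have YZ := regZ Y rY.
apply/seteqP; split=> x; first by rewrite -YZ; apply.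
by move=> Zx H /regZ ->.
Qed.

End Regulator.

(** * The regulator of a direct sum *)

Section RegulatorSum.
Variable V : vectType rat.
Implicit Types (x y : V) (p : primeT) (t : gtype).

Lemma inf_div_mulrn (G A : set V) N x p : (forall y, G y -> A (y *+ N)) ->
  inf_div G x p -> inf_div A (x *+ N) p.
Proof.
move=> GA dx k; have [y /GA Ay ->] := dx k; exists (y *+ N) => //.
by rewrite -!mulrnA mulnC.
Qed.

(** Infinite divisibility at the primes inverted in the type survives
    multiplication by [N], and it characterises the homogeneous component. *)
Lemma summand_mulrn_homog (G A K : set V) (U : set gtype) N k m
    (Y : 'I_m -> set V) j y :
  subgroup G -> completely_decomposable A -> A `<=` G ->
  crit A `<=` U -> (forall t, U t -> idempotent_type t) -> separated U ->
  (0 < N)%N -> (forall x, G x -> A (x *+ N)) ->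
  cd_decomp K Y -> K `<=` G -> has_index G K k -> Y j y ->
  crit A (type_of (Y j)) /\ homog A (type_of (Y j)) (y *+ N).
Proof.
move=> sG cA AG AU idU sepU N0 GA cY KG iK Yy; have cK : completely_decomposable K.
  by exists m, Y.
have eAK : crit A = crit K.
  apply: (crit_quasi cA cK (fact_gt0 k) N0) => [x /AG|x /KG /GA //].
  exact: has_index_mulrn (cd_subgroup cY) iK.
have At : crit A (type_of (Y j)) by rewrite eAK; apply/(critP _ cY); exists j.
have Gy := KG _ (cd_sub cY Yy).
split=> //; apply/(homogP cA AU idU sepU _ (AU _ At)); split; first exact: GA.
move=> p Pp; apply: (inf_div_mulrn GA).
apply: inf_div_sub (rank1_Pinf (cd_rank1 j cY) Pp Yy).
by move=> z /(cd_sub cY)/KG.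
Qed.

(** The purifications of the rank-one summands again have rank one, so their
    sum is completely decomposable; it contains every completely decomposable
    subgroup of finite index, hence is the regulator.  The summands were
    therefore pure from the start. *)
Lemma rigid_homog_pure (G : set V) (U : set gtype) t x n :
  ACD G -> completely_decomposable (Reg G) ->
  (forall t, crit (Reg G) t -> rank1 (homog (Reg G) t)) ->
  crit (Reg G) `<=` U -> (forall t, U t -> idempotent_type t) -> separated U ->
  U t -> G x -> (0 < n)%N -> homog (Reg G) t (x *+ n) -> homog (Reg G) t x.
Proof.
move=> aG; set B := Reg G => cB r1 BU idU sepU Ut Gx n0 hx.
have [sG _] := aG; have BG : B `<=` G := Reg_sub aG.
have sB : subgroup B := Reg_subgroup G.
have [N N0 GB] := Reg_bounded aG; have [m [X cX]] := cB.
have [c cc] := components_exist cX.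
pose Z i := [set y | G y /\ exists2 k, (0 < k)%N & X i (y *+ k)].
have sX i : subgroup (X i) := rank1_subgroup (cd_rank1 i cX).
have sZ i : subgroup (Z i).
  split; first by split; [exact: subgroup0|exists 1%N => //; exact: subgroup0].
  move=> y z [Gy [k k0 Xk]] [Gz [l l0 Xl]]; split; first exact: subgroupB.
  exists (k * l)%N; first by rewrite muln_gt0 k0.
  rewrite mulrnBl mulrnA [in X in _ - X]mulnC [in X in _ - X]mulrnA.
  by apply: subgroupB => //; apply: subgroupMn.
have ZX i y : Z i y -> X i (y *+ N).
  move=> [Gy [k k0 Xk]]; apply: (summand_pure cX k0 (GB y Gy)).
  by rewrite -mulrnA mulnC mulrnA; apply: subgroupMn.
have cZ : cd_decomp (sumset setT Z) Z.
  split=> // [i|z Zz sz i _].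
    split=> //; have [_ [y [Xy y0 yq]]] := cd_rank1 i cX.
    exists y; split=> //; first by split; [exact: BG (cd_sub cX Xy)|exists 1%N].
    move=> z [_ [k k0 /yq[q zq]]]; exists (q / k%:R).
    apply: (mulrn_inj k0); rewrite zq -scaler_nat scalerA mulrC divfK //.
    by rewrite pnatr_eq0 -lt0n.
  apply: (mulrn_eq0 N0).
  have -> : z i *+ N = c i (\sum_j z j *+ N).
    by case: cc => _ _ ->// j; apply/ZX/Zz.
  by rewrite sumrMnl -fsum_ordT sz mul0rn (component0 cX cc).
have ZG : sumset setT Z `<=` G by apply: sumset_sub => // i _ y [].
have key u y : crit B u -> G y -> (exists2 k, (0 < k)%N & homog B u (y *+ k)) ->
    sumset setT Z y.
  move=> Bu Gy [k k0 hy]; have [i ui] := (critP u cX).1 Bu.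
  have [w Xw w0] := rank1_neq0 (cd_rank1 i cX).
  have hw : homog B u w by rewrite -ui; apply: summand_homog Xw.
  have [a [b [b0 yw]]] := rank1_commensurable (r1 u Bu) hw hy w0.
  apply: (@sub_sumset _ _ _ Z i); [by move=> j _; exact: subgroup0|by []|].
  split=> //; exists (k * `|b|)%N; first by rewrite muln_gt0 k0 absz_gt0.
  by rewrite mulrnA; apply: subgroup_absz => //; rewrite yw; apply: subgroupMz.
have BZ : B = sumset setT Z.
  apply: Reg_greatest => //; first by exists m, Z.
  move=> K k [l [Y cY]] KG iK; have [_ _ KE] := cY; rewrite [K in K `<=` _]KE.
  apply: sumset_sub; first exact: cd_subgroup cZ.
  move=> j _ y Yy.
  have [Bu hy] := summand_mulrn_homog sG cB BG BU idU sepU N0 GB cY KG iK Yy.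
  by apply: key Bu _ _; [exact: KG (cd_sub cY Yy)|exists N].
have [Bt|nBt] := pselect (crit B t); last first.
  have xn0 := homog_ncrit Ut nBt hx; rewrite (mulrn_eq0 n0 xn0).
  exact: subgroup0 (subgroup_homog cB BU idU sepU Ut).
have Bx : B x by rewrite BZ; apply: key Bt Gx _; exists n.
apply/(homogP cB BU idU sepU x Ut); split=> // p Pp.
apply: (@inf_div_mulz _ _ _ n%:Z) => //; first by rewrite -lt0n in n0 *.
by rewrite -pmulrn; apply: homog_inf_div hx Pp.
Qed.

Section Sum.
Variables (G G1 C : set V).
Let A := Reg G.
Let B := Reg G1.
Hypotheses (aG : ACD G) (aG1 : ACD G1) (sC : subgroup C)
  (GE : G = addset G1 C) (G1C : G1 `&` C = [set 0])
  (cdA : completely_decomposable A) (cdB : completely_decomposable B)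
  (cdC : completely_decomposable C)
  (id_A : forall t, crit A t -> idempotent_type t) (sep_A : separated (crit A))
  (r1B : forall t, crit B t -> rank1 (homog B t)).

Let sG1 : subgroup G1. Proof. by case: aG1. Qed.
Let sG : subgroup G. Proof. by case: aG. Qed.
Let sB : subgroup B. Proof. exact: Reg_subgroup. Qed.
Let BG1 : B `<=` G1. Proof. exact: Reg_sub. Qed.

Lemma direct_sum_inj x y x' y' :
  G1 x -> C y -> G1 x' -> C y' -> x + y = x' + y' -> x = x' /\ y = y'.
Proof.
move=> Gx Cy Gx' Cy' e; have xy : x - x' = y' - y.
  by apply/eqP; rewrite subr_eq addrAC eq_sym subr_eq e addrC.
have : (G1 `&` C) (x - x').
  by split; [exact: subgroupB|rewrite xy; apply: subgroupB].
rewrite G1C => /= x0; split; apply/eqP; rewrite eq_sym -subr_eq0.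
  by rewrite -opprB x0 oppr0.
by rewrite -xy x0.
Qed.

Lemma BC0 : B `&` C = [set 0].
Proof.
apply/seteqP; split=> [x [/BG1 Gx Cx]|_ ->]; first by rewrite -G1C.
by split; apply: subgroup0.
Qed.

Lemma cd_BC : completely_decomposable (addset B C).
Proof.
have [n [X cX]] := cdB; have [m [Y cY]] := cdC.
by eexists _, _; apply: cd_addset cX cY BC0.
Qed.

Lemma BC_sub : addset B C `<=` G.
Proof.
by move=> _ [x /BG1 Gx [y Cy <-]]; rewrite GE; exists x => //; exists y.
Qed.

Lemma BC_bounded : exists2 N, (0 < N)%N &
  (forall x, G1 x -> B (x *+ N)) /\ forall x, G x -> addset B C (x *+ N).
Proof.
have [N N0 GB] := Reg_bounded aG1; exists N => //; split=> //.
rewrite GE => _ [x Gx [y Cy <-]]; exists (x *+ N); first exact: GB.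
by exists (y *+ N); [apply: subgroupMn|rewrite mulrnDl].
Qed.

Lemma crit_Reg_sum : crit A = crit B `|` crit C.
Proof.
rewrite -(crit_addset cdB cdC BC0).
have [N N0 GA] := Reg_bounded aG; have [M M0 [_ GBC]] := BC_bounded.
apply: (crit_quasi cdA cd_BC M0 N0) => [x /(Reg_sub aG)/GBC//|x /BC_sub/GA//].
Qed.

Lemma critB_A : crit B `<=` crit A.
Proof. by rewrite crit_Reg_sum => t; left. Qed.

Lemma critC_A : crit C `<=` crit A.
Proof. by rewrite crit_Reg_sum => t; right. Qed.

Let hB t x := @homogP _ B (crit A) cdB critB_A id_A sep_A t x.
Let hC t x := @homogP _ C (crit A) cdC critC_A id_A sep_A t x.

Lemma homogB_pure t x n : crit A t -> G1 x -> (0 < n)%N ->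
  homog B t (x *+ n) -> homog B t x.
Proof. exact: rigid_homog_pure aG1 cdB r1B critB_A id_A sep_A. Qed.

Lemma inf_div_addset x y p : B x -> C y ->
  inf_div (addset B C) (x + y) p -> inf_div B x p /\ inf_div C y p.
Proof.
move=> Bx Cy d; split=> k; have [_ [x' Bx' [y' Cy' <-]] e] := d k;
  rewrite mulrnDl in e;
  have [ex ey] := direct_sum_inj (BG1 Bx) Cy (BG1 (subgroupMn _ sB Bx'))
                    (subgroupMn _ sC Cy') e.
  by exists x'.
by exists y'.
Qed.

Let addset_homog_BC t x : crit A t -> homog (addset B C) t x ->
  addset (homog B t) (homog C t) x.
Proof.
move=> At; have BCA : crit (addset B C) `<=` crit A.
  by rewrite (crit_addset cdB cdC BC0) -crit_Reg_sum.
move=> /(homogP cd_BC BCA id_A sep_A x At)[[y By [z Cz <-]] d].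
exists y; first by apply/(hB _ At); split=> // p /d /inf_div_addset[].
by exists z => //; apply/(hC _ At); split=> // p /d /inf_div_addset[].
Qed.

Let hull_homog_BC t x n : crit A t -> G x -> (0 < n)%N ->
  addset (homog B t) (homog C t) (x *+ n) -> addset (homog B t) (homog C t) x.
Proof.
move=> At; rewrite GE => -[y Gy [z Cz <-]] n0 [y' By' [z' Cz' e]].
rewrite mulrnDl in e; have [By Cz''] := (homog_sub By', homog_sub Cz').
have [ey ez] := direct_sum_inj (BG1 By) Cz'' (subgroupMn n sG1 Gy)
  (subgroupMn n sC Cz) e.
exists y; first by apply: (homogB_pure At Gy n0); rewrite -ey.
exists z => //; apply/(hC _ At); split=> // p Pp.
apply: (@inf_div_mulz _ _ _ n%:Z) => //; first by rewrite -lt0n in n0 *.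
by rewrite -pmulrn -ez; apply: homog_inf_div Cz' Pp.
Qed.

(** The sum of the components of one type of [B] and [C] is pure in [G], because
    these components are pure in [G1] and in [C]; so a summand of any competitor, being
    infinitely divisible at the primes of its type, falls into [B] plus [C]. *)
Lemma Reg_sum : A = addset B C.
Proof.
have BCA : crit (addset B C) `<=` crit A.
  by rewrite (crit_addset cdB cdC BC0) -crit_Reg_sum.
have sBC : subgroup (addset B C) by apply: subgroup_addset.
apply: Reg_greatest => //; [exact: cd_BC|exact: BC_sub|].
move=> K k [l [Y cY]] KG iK; have [_ _ KE] := cY; rewrite [K in K `<=` _]KE.
apply: sumset_sub => // j _ y Yy; have [M M0 [_ GBC]] := BC_bounded.
have [Bt hy] := summand_mulrn_homog sG cd_BC BC_sub BCA id_A sep_A M0 GBC cY KG iK Yy.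
have Gy := KG _ (cd_sub cY Yy); have At := BCA _ Bt.
have [b /homog_sub Bb [c /homog_sub Cc <-]] :=
  hull_homog_BC At Gy M0 (addset_homog_BC At hy).
by exists b => //; exists c.
Qed.

Lemma homog_Reg_sum t : crit A t -> homog A t = addset (homog B t) (homog C t).
Proof.
move=> At; have BCA : crit (addset B C) `<=` crit A by rewrite -Reg_sum.
apply/seteqP; split=> [x|_ [b hb [c hc <-]]].
  by rewrite {1}Reg_sum; apply: addset_homog_BC.
have [Bb db] := (hB b At).1 hb; have [Cc dc] := (hC c At).1 hc.
have sBC : subgroup (addset B C) by apply: subgroup_addset.
have BBC : B `<=` addset B C.
  by move=> x Bx; exists x => //; exists 0; [exact: subgroup0|rewrite addr0].
have CBC : C `<=` addset B C.
  by move=> x Cx; exists 0; [exact: subgroup0|exists x; rewrite ?add0r].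
rewrite Reg_sum; apply/(homogP cd_BC BCA id_A sep_A _ At).
split=> [|p Pp]; first by apply: subgroupD => //; [apply: BBC|apply: CBC].
have [] // := subgroupD (subgroup_inf_div p sBC)
  (conj (BBC b Bb) (inf_div_sub BBC (db p Pp)))
  (conj (CBC c Cc) (inf_div_sub CBC (dc p Pp))).
Qed.

Lemma homogA_pure t x n : crit A t -> G x -> (0 < n)%N ->
  homog A t (x *+ n) -> homog A t x.
Proof. by move=> At; rewrite homog_Reg_sum //; apply: hull_homog_BC. Qed.

End Sum.
End RegulatorSum.

(** * The rings of coefficients *)

Section Coefficients.
Variable t : gtype.

Lemma P_numberM (P : set primeT) (z w : int) :
  P_number P z -> P_number P w -> P_number P (z * w).
Proof.
move=> [z0 zP] [w0 wP]; split; first by rewrite mulf_neq0.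
by move=> p; rewrite abszM Euclid_dvdM ?(valP p) // => /orP[/zP|/wP].
Qed.

Lemma P_number1 (P : set primeT) : P_number P 1.
Proof.
by split=> // p; rewrite dvdn1 => /eqP p1; have := valP p; rewrite p1.
Qed.

Lemma Rt_int (z : int) : Rt t z%:~R.
Proof. by exists z, 1; split; [exact: P_number1|rewrite divr1]. Qed.

Lemma Rt0 : Rt t 0. Proof. exact: (Rt_int 0). Qed.

Lemma Rt1 : Rt t 1. Proof. exact: (Rt_int 1). Qed.

Lemma RtM a b : Rt t a -> Rt t b -> Rt t (a * b).
Proof.
move=> [z [w [Pw ->]]] [z' [w' [Pw' ->]]]; exists (z * z'), (w * w').
by split; [exact: P_numberM|rewrite !intrM mulf_div].
Qed.

Lemma RtV (w : int) : P_number (Pinf t) w -> Rt t w%:~R^-1.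
Proof. by move=> Pw; exists 1, w; split=> //; rewrite mul1r. Qed.

Lemma RtD a b : Rt t a -> Rt t b -> Rt t (a + b).
Proof.
move=> [z [w [Pw ->]]] [z' [w' [Pw' ->]]].
exists (z * w' + z' * w), (w * w'); split; first exact: P_numberM.
have [[w0 _] [w0' _]] := (Pw, Pw').
by rewrite addf_div ?intr_eq0 // intrD !intrM.
Qed.

(** The numerator would be divisible by every power of [p]. *)
Lemma Rt_inf_div p a : ~ Pinf t p -> Rt t a ->
  (forall k, exists2 b, Rt t b & a = b *+ (val p ^ k)%N) -> a = 0.
Proof.
move=> np [z [w [[w0 Pw] ->]]] div; have [->|z0] := eqVneq z 0; first by rewrite mul0r.
have pw : ~~ (val p %| `|w|)%N by apply/negP => /Pw.
have pz k : (val p ^ k %| `|z|)%N.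
  have [b [z' [w' [[w0' Pw'] ->]]] e] := div k.
  have pw' : ~~ (val p %| `|w'|)%N by apply/negP => /Pw'.
  have : z * w' = z' * w * (val p ^ k)%N%:Z.
    apply/eqP; rewrite -(eqr_int rat) !intrM -pmulrn.
    move/eqP: e; rewrite -mulr_natr mulrAC eqr_div ?intr_eq0 //.
    by rewrite mulrAC [in X in _ == X]mulrAC.
  move/(congr1 absz); rewrite !abszM absz_nat => e'.
  rewrite -(@Gauss_dvdl _ _ `|w'|) ?e' ?dvdn_mull //.
  by apply: coprimeXl; rewrite prime_coprime ?(valP p).
have : (val p ^ `|z| <= `|z|)%N by rewrite dvdn_leq // absz_gt0.
by rewrite leqNgt ltn_expl // prime_gt1 // (valP p).
Qed.

Let pi : nat_pred := [pred q | `[< exists p : primeT, val p = q /\ Pinf t p >]].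

(** Splitting off the part of the numerator that is prime to the inverted
    primes realises the normal form of a coefficient, up to a unit. *)
Lemma barP a : Rt t a -> exists u, [/\ Rt t u, Rt t u^-1, u != 0
  & a = (bar t a)%:R * u].
Proof.
move=> [z [w [Pw ea]]]; rewrite /bar; case: eqP => [->|/eqP a0].
  by exists 1; rewrite invr1 mul0r; split=> //; exact: Rt1.
set P := [set n : nat | _].
suff /(xgetPex 0%N)[n0 _ [u [v [Pu Pv]]]] : exists n, P n.
  have [u0 v0] : u%:~R != 0 :> rat /\ v%:~R != 0 :> rat.
    by rewrite !intr_eq0; case: Pu Pv => ? _ [].
  move=> ->; exists (u%:~R / v%:~R); split=> //.
  - by apply: RtM; [exact: Rt_int|exact: RtV].
  - by rewrite invf_div; apply: RtM; [exact: Rt_int|exact: RtV].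
  - by rewrite mulf_neq0 // invr_eq0.
have z0 : z != 0 by apply: contraNneq a0; rewrite ea => ->; rewrite mul0r.
have z0' : (0 < `|z|)%N by rewrite absz_gt0.
pose n := `|z|%N; exists (n`_pi^')%N; split; first exact: part_gt0.
  split=> [|p pz]; first by rewrite -lt0n; exact: part_gt0.
  move=> Pp; have /pnatP h := part_pnat pi^' n.
  have := h (part_gt0 _ _) (val p) (valP p) pz; rewrite inE /= /in_mem /=.
  by apply/negP; rewrite negbK; apply/asboolP; exists p.
exists (sgz z * (n`_pi)%N%:Z), w; split=> //.
  split; first by rewrite mulf_neq0 ?sgz_eq0 // -lt0n; exact: part_gt0.
  move=> p; have sz1 : `|sgz z|%N = 1%N by case: sgzP z0.
  rewrite abszM sz1 mul1n /= => pz.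
  have /pnatP h := part_pnat pi n.
  have := h (part_gt0 _ _) (val p) (valP p) pz; rewrite /in_mem /=.
  by move/asboolP => [q [/val_inj -> ]].
rewrite ea mulrA; congr (_ / _).
have ez : z = (n`_pi^')%N%:Z * (sgz z * (n`_pi)%N%:Z).
  by rewrite mulrCA -PoszM mulnC partnC // {1}[z]intEsg.
by rewrite {1}ez intrM.
Qed.

End Coefficients.

Section GcdIdeal.
Variable V : vectType rat.

Lemma subgroup_gcd (H : set V) x m n : subgroup H ->
  H (x *+ m) -> H (x *+ n) -> H (x *+ gcdn m n).
Proof.
move=> sH Hm Hn; have [u [v uv]] := Bezoutz m n.
have -> : x *+ gcdn m n = x *+ m *~ u + x *+ n *~ v.
  by rewrite !pmulrn -!mulrzA -mulrzDr [m%:Z * u]mulrC [n%:Z * v]mulrC uv.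
by apply: subgroupD => //; apply: subgroupMz.
Qed.

Lemma subgroup_biggcd (H : set V) (I : choiceType) (D : set I) (F : I -> nat) x :
  subgroup H -> finite_set D -> (forall i, D i -> H (x *+ F i)) ->
  H (x *+ \big[gcdn/0%N]_(i \in D) F i).
Proof.
move=> sH fD HF; rewrite fsbig_finite // big_seq.
apply: (big_ind (fun n => H (x *+ n))) => [|m n|i].
- by rewrite mulr0n; apply: subgroup0.
- exact: subgroup_gcd.
- by rewrite in_fset_set // inE => /HF.
Qed.

Lemma dvdn_biggcd (I : choiceType) (D : set I) (F : I -> nat) i :
  finite_set D -> D i -> (\big[gcdn/0%N]_(i \in D) F i %| F i)%N.
Proof. by move=> fD Di; rewrite (fsbigD1 i) //=; apply: dvdn_gcdl. Qed.

End GcdIdeal.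

(** * Coordinates *)

Section Coordinates.
Variable V : vectType rat.
Implicit Types (x y : V) (t : gtype).

Lemma divides_in_P_number (M : set V) t n x :
  (forall p x, Pinf t p -> M x -> divides_in M x (val p)) ->
  P_number (Pinf t) n%:Z -> M x -> divides_in M x n.
Proof.
move=> divM; elim/ltn_ind: n x => n IHn x [n0 Pn] Mx.
have [n1|n1] := leqP n 1.
  by exists x => //; case: n n0 n1 {IHn Pn} => [//|[|//]] _ _; rewrite mulr1n.
pose p : primeT := exist _ (pdiv n) (pdiv_prime n1).
have np : n = (n %/ pdiv n * pdiv n)%N by rewrite divnK ?pdiv_dvd.
have Pp : Pinf t p by apply: Pn; rewrite /= pdiv_dvd.
have [y My ->] := divM p x Pp Mx.
have [||z Mz ->] := IHn (n %/ pdiv n)%N _ y _ My.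
- by rewrite ltn_Pdiv ?prime_gt1 ?pdiv_prime // (ltn_trans _ n1).
- split; first by move: n0; apply: contraNneq => /= -[e]; rewrite np e mul0n.
  by move=> q /= qn; apply: Pn => /=; rewrite np dvdn_mulr.
by exists z => //; rewrite -mulrnA -np.
Qed.

Lemma Rt_scale (M : set V) t q x : subgroup M ->
  (forall p x, Pinf t p -> M x -> divides_in M x (val p)) ->
  Rt t q -> M x -> M (q *: x).
Proof.
move=> sM divM [z [w [[w0 Pw] ->]]] Mx.
have Pw' : P_number (Pinf t) `|w|%N by split=> //; rewrite -lt0n absz_gt0.
have [y My ->] := divides_in_P_number divM Pw' Mx.
have -> : (z%:~R / w%:~R) *: (y *+ `|w|%N) = y *~ (z * sgz w).
  rewrite -scaler_int -scaler_nat scalerA; congr (_ *: _).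
  have -> : (`|w|%N)%:R = (sgz w)%:~R * w%:~R :> rat.
    by rewrite -intrM -abszEsg.
  by rewrite [_ * w%:~R]mulrC mulrA divfK ?intr_eq0 // intrM.
exact: subgroupMz.
Qed.

Lemma homog_scale (A : set V) (U : set gtype) t q x :
  completely_decomposable A -> crit A `<=` U ->
  (forall t, U t -> idempotent_type t) -> separated U -> U t ->
  Rt t q -> homog A t x -> homog A t (q *: x).
Proof.
move=> cA AU idU sepU Ut; apply: Rt_scale; first exact: subgroup_homog sepU _ Ut.
move=> p {}x Pp hx; have [Ax dx] := (homogP cA AU idU sepU x Ut).1 hx.
have [y Ay xy] := dx p Pp 1%N; rewrite expn1 in xy; exists y => //.
apply/(homogP cA AU idU sepU y Ut); split=> // r Pr.
have p0 : (val p)%:Z != 0 by rewrite -lt0n prime_gt0 // (valP p).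
apply: (inf_div_mulz (completely_decomposable_subgroup cA) Ay p0).
by rewrite -pmulrn -xy; apply: dx.
Qed.

Lemma common_denominator (I : eqType) (S : seq I) (q : I -> rat) :
  exists2 N, (0 < N)%N & forall j, j \in S -> exists z : int, q j * N%:R = z%:~R.
Proof.
elim: S => [|i S [N N0 SN]]; first by exists 1%N.
exists (`|denq (q i)| * N)%N; first by rewrite muln_gt0 absz_gt0 denq_neq0.
move=> j; rewrite inE => /orP[/eqP ->|/SN[z e]].
  exists (numq (q i) * N%:Z); rewrite natrM mulrA intrM numqE; congr (_ * _ * _).
  by rewrite -{2}[denq _](@gez0_abs) // ltW.
exists (z * `|denq (q i)|%:Z); rewrite natrM mulrCA e mulrC intrM.
by [].
Qed.

(** Additivity on [G] yields linearity for rational coefficients after clearing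
    their denominators, as [V] is torsion-free. *)
Lemma additive_expand (G : set V) (phi : V -> V) (I : eqType) (S : seq I)
    (q : I -> rat) (v : I -> V) : subgroup G ->
  (forall x y, G x -> G y -> phi (x + y) = phi x + phi y) ->
  (forall j, j \in S -> G (v j)) -> G (\sum_(j <- S) q j *: v j) ->
  phi (\sum_(j <- S) q j *: v j) = \sum_(j <- S) q j *: phi (v j).
Proof.
move=> sG phiD Gv Gx; have G0 := subgroup0 sG.
have phi0 : phi 0 = 0 by apply: (addrI (phi 0)); rewrite -phiD // !addr0.
have phiN x : G x -> phi (- x) = - phi x.
  by move=> Gy; apply/eqP; rewrite -addr_eq0 -phiD ?addNr ?phi0 //; apply: subgroupN.
have phiMn x n : G x -> phi (x *+ n) = phi x *+ n.
  move=> Gy; elim: n => [|n IHn]; first by rewrite !mulr0n.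
  by rewrite !mulrS phiD ?IHn //; apply: subgroupMn.
have phiMz x z : G x -> phi (x *~ z) = phi x *~ z.
  move=> Gy; case: z => n; first by rewrite -!pmulrn phiMn.
  by rewrite NegzE !mulrNz phiN -?pmulrn ?phiMn //; apply: subgroupMn.
have [N N0 SN] := common_denominator S q.
have clear_den w : (\sum_(j <- S) q j *: w j) *+ N
    = \sum_(j <- S) w j *~ (numq (q j * N%:R)).
  rewrite -sumrMnl big_seq [RHS]big_seq; apply: eq_bigr => j /SN[z e].
  rewrite -scaler_nat scalerA mulrC -scaler_int; congr (_ *: _).
  by rewrite e numq_int.
apply: (mulrn_inj N0); rewrite -phiMn // !clear_den.
elim: S {Gx SN clear_den} Gv => [|j S IH] Gv; first by rewrite !big_nil.
have Gj : G (v j) by apply: Gv; rewrite inE eqxx.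
have GS i : i \in S -> G (v i) by move=> iS; apply: Gv; rewrite inE iS orbT.
rewrite !big_cons phiD ?phiMz ?IH //; first exact: subgroupMz.
by rewrite big_seq; apply: subgroup_sum => // i /GS Gi; apply: subgroupMz.
Qed.

(** Clearing denominators makes integral independence the same as independence
    over the rationals.  The functionals are total on [V], so they can be used
    to write down multiplications. *)
Lemma dual_family (I : choiceType) (S : seq I) (v : I -> V) : uniq S ->
  (forall z : I -> int, \sum_(j <- S) v j *~ z j = 0 ->
     forall j, j \in S -> z j = 0) ->
  exists f : I -> V -> rat,
    [/\ forall j x y, f j (x + y) = f j x + f j y,
        forall j a x, f j (a *: x) = a * f j x
      & forall (q : I -> rat) j, j \in S -> f j (\sum_(k <- S) q k *: v k) = q j].
Proof.
move=> uS indep; case: S => [|i0 S0] in uS indep *.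
  by exists (fun _ _ => 0); split=> // *; rewrite ?addr0 ?mulr0.
set S := i0 :: S0 in uS indep *.
have sumE (w : I -> V) : \sum_(j <- S) w j = \sum_(i < size S) w (nth i0 S i).
  by rewrite (big_nth i0) big_mkord.
pose X := [tuple v (nth i0 S i) | i < size S].
have XE (i : 'I_(size S)) : X`_i = v (nth i0 S i) by rewrite -tnth_nth tnth_mktuple.
have freeX : free X.
  apply/freeP => k k0 i; have [N N0 SN] := common_denominator S (fun j =>
    if insub (index j S) is Some i then k i else 0).
  have kn (l : 'I_(size S)) :
      (if insub (index (nth i0 S l) S) is Some i then k i else 0) = k l.
    by rewrite index_uniq // valK.
  have kz (l : 'I_(size S)) : (numq (k l * N%:R))%:~R = k l * N%:R.
    have [z] := SN (nth i0 S l) (mem_nth _ (ltn_ord l)).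
    by rewrite kn => ->; rewrite numq_int.
  pose z j := numq ((if insub (index j S) is Some i then k i else 0) * N%:R).
  have sz : \sum_(j <- S) v j *~ z j = 0.
    rewrite sumE; transitivity ((\sum_(i < size S) k i *: X`_i) *+ N).
      2: by rewrite k0 mul0rn.
    rewrite -sumrMnl; apply: eq_bigr => l _.
    by rewrite /z kn XE -scaler_int kz -scaler_nat scalerA mulrC.
  have := indep z sz _ (mem_nth i0 (ltn_ord i)); rewrite /z kn => zi.
  apply/eqP; suff /eqP : k i * N%:R = 0.
    by rewrite mulf_eq0 pnatr_eq0 (gtn_eqF N0) orbF.
  by rewrite -kz zi.
pose f j x : rat := if insub (index j S) is Some i then coord X i x else 0.
exists f; split.
- by move=> j x y; rewrite /f; case: insub => [i|]; rewrite ?linearD ?addr0.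
- by move=> j a x; rewrite /f; case: insub => [i|]; rewrite ?linearZ ?mulr0.
move=> q j jS; have jn : (index j S < size S)%N by rewrite index_mem.
rewrite /f insubT sumE /=.
under eq_bigr do rewrite -XE.
by rewrite coord_sum_free //= nth_index.
Qed.

End Coordinates.

(** * Absolute ideals *)

(** The elements of the two kinds in the basis are treated alike: [c j / m j] and
    [s j / m j] are the coordinates of [g] and [d] at [j], where [m j = 1] and
    [s j = 0] unless [j] belongs to the part of the basis that spans [Reg G1].
    The condition [s_uniq] says that [d] has at most one non-zero coordinate in
    each homogeneous component, which makes that coordinate the whole
    component. *)
Section Core.
Variable V : vectType rat.
Variables (G A : set V) (T : set gtype) (M : gtype -> set V).
Variables (S : seq (gtype * nat)) (E : gtype * nat -> V)
  (f : gtype * nat -> V -> rat) (d g : V).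
Variables (c : gtype * nat -> rat) (s : gtype * nat -> int)
  (m : gtype * nat -> nat).
Hypotheses (sG : subgroup G) (AG : A `<=` G) (fT : finite_set T)
  (sM : forall t, T t -> subgroup (M t)) (AE : A = sumset T M)
  (GE : G = addset (gen [set d]) A) (Gg : G g).
Hypotheses (uS : uniq S) (ST : forall j, j \in S -> T j.1)
  (EM : forall j, j \in S -> M j.1 (E j))
  (fD : forall j x y, f j (x + y) = f j x + f j y)
  (fZ : forall j q x, f j (q *: x) = q * f j x)
  (fE : forall (q : gtype * nat -> rat) j, j \in S ->
     f j (\sum_(k <- S) q k *: E k) = q j)
  (f_expand : forall x, G x -> x = \sum_(j <- S) f j x *: E j)
  (f_off : forall t x j, T t -> M t x -> j \in S -> j.1 <> t -> f j x = 0)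
  (M_scale : forall t q x, T t -> Rt t q -> M t x -> M t (q *: x))
  (M_endo : forall phi t x, (forall y, G y -> G (phi y)) ->
     (forall y z, G y -> G z -> phi (y + z) = phi y + phi z) ->
     T t -> M t x -> M t (phi x)).
Hypotheses (m_gt0 : forall j, j \in S -> (0 < m j)%N)
  (sm : forall j, j \in S -> coprimez (s j) (m j)%:Z)
  (s_uniq : forall j k, j \in S -> k \in S -> j.1 = k.1 ->
     s j != 0 -> s k != 0 -> j = k)
  (f_d : forall j, j \in S -> f j d = (s j)%:~R / (m j)%:R)
  (f_g : forall j, j \in S -> f j g = c j / (m j)%:R)
  (f_Rt : forall j x, j \in S -> G x -> Rt j.1 ((m j)%:R * f j x)).

Let MA t : T t -> M t `<=` A.
Proof.
by move=> Tt; rewrite AE; apply: sub_sumset => // u Tu; exact: subgroup0 (sM Tu).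
Qed.

Let GM t : T t -> M t `<=` G.
Proof. by move=> Tt x /(MA Tt)/AG. Qed.

Let sA : subgroup A. Proof. by rewrite AE; apply: subgroup_sumset. Qed.

Let GE_E j : j \in S -> G (E j).
Proof. by move=> jS; apply: (GM (ST jS)); apply: EM. Qed.

Let proj t x := \sum_(j <- S | j.1 == t) f j x *: E j.

Let projD t x y : proj t (x + y) = proj t x + proj t y.
Proof.
rewrite /proj -big_split /=; apply: eq_bigr => j _; by rewrite fD scalerDl.
Qed.

Let projZ t q x : proj t (q *: x) = q *: proj t x.
Proof.
by rewrite /proj scaler_sumr; apply: eq_bigr => j _; rewrite fZ scalerA.
Qed.

Let proj_id t x : T t -> M t x -> proj t x = x.
Proof.
move=> Tt Mx; rewrite [RHS](f_expand (GM Tt Mx)) /proj big_mkcond /=.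
rewrite big_seq [RHS]big_seq; apply: eq_bigr => j jS; case: eqP => // jt.
by rewrite (f_off Tt Mx jS jt) scale0r.
Qed.

Let proj_off t u x : T u -> M u x -> t <> u -> proj t x = 0.
Proof.
move=> Tu Mx tu; rewrite /proj big_seq_cond big1 // => j /andP[jS /eqP jt].
by rewrite (f_off Tu Mx jS) ?scale0r // jt.
Qed.

Let subgroup_ker_proj t : subgroup [set z | proj t z = 0].
Proof.
split=> [|v w /= pv pw]; first by have := projZ t 0 0; rewrite !scale0r.
by rewrite projD pv add0r -scaleN1r projZ pw scaler0.
Qed.

Let proj_A t x : T t -> A x -> M t (proj t x).
Proof.
move=> Tt; rewrite AE => -[y My ->]; rewrite (fsbigD1 t) // projD.
rewrite (proj_id Tt (My t Tt)) [X in _ + X](_ : _ = 0) ?addr0; first exact: My.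
suff : [set z | proj t z = 0] (\sum_(u \in T `\ t) y u) by [].
apply: subgroup_fsum => [|u [Tu /= ut]]; first exact: subgroup_ker_proj.
by apply: (proj_off Tu (My u Tu)); apply: nesym.
Qed.

Section Endomorphism.
Variables (phi : V -> V) (k : int).
Hypotheses (phiG : forall y, G y -> G (phi y))
  (phiD : forall y z, G y -> G z -> phi (y + z) = phi y + phi z).

Let v j := phi (E j) - E j *~ k.

Let Mv j : j \in S -> M j.1 (v j).
Proof.
move=> jS; have Tj := ST jS; apply: (subgroupB (sM Tj)).
  exact: M_endo (EM jS).
by apply: (subgroupMz _ (sM Tj)); apply: EM.
Qed.

Lemma deviation_expand x : G x -> phi x - x *~ k = \sum_(j <- S) f j x *: v j.
Proof.
move=> Gx; have Gsx : G (\sum_(j <- S) f j x *: E j) by rewrite -f_expand.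
rewrite {1 2}(f_expand Gx) (additive_expand sG phiD GE_E Gsx).
rewrite mulrz_suml -sumrB; apply: eq_bigr => j _.
by rewrite /v scalerBr -!scaler_int !scalerA [_ * k%:~R]mulrC.
Qed.

(** Modulo [A], an endomorphism multiplies [d] by an integer [k].  Its deviation
    from multiplication by [k] carries each basis element into a multiple of
    the denominator of [d] there, because numerator and denominator are
    coprime. *)
Lemma deviation_divisible j : A (phi d - d *~ k) -> G d -> j \in S ->
  M j.1 ((m j)%:R^-1 *: v j).
Proof.
move=> Ad Gd jS; have Tj := ST jS; have sMj := sM Tj.
have m0 : (m j)%:R != 0 :> rat by rewrite pnatr_eq0 -lt0n; apply: m_gt0.
have /coprimezP[[x y] /= xy] := sm jS.
suff Msv : M j.1 (((s j)%:~R / (m j)%:R) *: v j).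
  have -> : (m j)%:R^-1 *: v j = ((s j)%:~R / (m j)%:R) *: v j *~ x + v j *~ y.
    rewrite -!scaler_int scalerA -scalerDl; congr (_ *: _).
    apply: (mulIf m0); rewrite mulVf // mulrDl -mulrA divfK //.
    by rewrite pmulrn -!intrM -intrD xy.
  by apply: (subgroupD sMj); apply: (subgroupMz _ sMj) => //; apply: Mv.
have [s0|s0] := eqVneq (s j) 0; first by rewrite s0 !mul0r scale0r; apply: subgroup0.
suff <- : proj j.1 (phi d - d *~ k) = ((s j)%:~R / (m j)%:R) *: v j.
  exact: proj_A.
rewrite (deviation_expand Gd).
rewrite (bigD1_seq j) //= projD projZ (proj_id Tj (Mv jS)) f_d //.
rewrite [X in _ + X](_ : _ = 0) ?addr0 // big_seq_cond.
suff : [set z | proj j.1 z = 0] (\sum_(i <- S | (i \in S) && (i != j)) f i d *: v i) by [].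
apply: subgroup_sum => [|i /andP[iS ij] /=]; first exact: subgroup_ker_proj.
rewrite projZ; have [ij1|ij1] := eqVneq i.1 j.1; last first.
  by rewrite (proj_off (ST iS) (Mv iS)) ?scaler0 //; apply/nesym/eqP.
rewrite f_d //; have [->|si0] := eqVneq (s i) 0; first by rewrite !mul0r scale0r.
by rewrite (s_uniq iS jS ij1 si0 s0) eqxx in ij.
Qed.

End Endomorphism.

Section Ideal.
Variable N : gtype -> set V.
Hypotheses (sN : forall t, T t -> subgroup (N t))
  (NM : forall t, T t -> N t `<=` M t)
  (cN : forall j w, j \in S -> M j.1 w -> N j.1 (c j *: w))
  (N_endo : forall phi t x, (forall y, G y -> G (phi y)) ->
     (forall y z, G y -> G z -> phi (y + z) = phi y + phi z) ->
     T t -> N t x -> N t (phi x)).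

Let J := addset (gen [set g]) (sumset T N).

Let sJ : subgroup J.
Proof. by apply: subgroup_addset; [exact: subgroup_gen|exact: subgroup_sumset]. Qed.

Let gJ : gen [set g] `<=` J.
Proof.
move=> x gx; exists x => //; exists 0; last by rewrite addr0.
exact: subgroup0 (subgroup_sumset fT sN).
Qed.

Let NJ t : T t -> N t `<=` J.
Proof.
move=> Tt x Nx; exists 0; first exact: subgroup0 (subgroup_gen _).
exists x; last by rewrite add0r.
by apply: (sub_sumset _ Tt Nx) => u /sN /subgroup0.
Qed.

(** The image of [g] is [k] times [g] plus the deviations along the basis,
    weighted by the coordinates [c j / m j] of [g]; the deviations are divisible
    by these very denominators. *)
Lemma endomorphism_generator phi : (forall y, G y -> G (phi y)) ->
  (forall y z, G y -> G z -> phi (y + z) = phi y + phi z) -> J (phi g).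
Proof.
move=> phiG phiD; have Gd : G d.
  rewrite GE; exists d; first by apply/gen1P; exists 1; rewrite mulr1z.
  by exists 0; [exact: subgroup0|rewrite addr0].
have := phiG d Gd; rewrite {1}GE => -[_ /gen1P[k ->] [b Ab kb]].
have Ad : A (phi d - d *~ k) by rewrite -kb addrC addKr.
rewrite -[phi g](subrK (g *~ k)); apply: (subgroupD sJ); last first.
  by apply: gJ; apply/gen1P; exists k.
rewrite (deviation_expand k phiD Gg) big_seq; apply: subgroup_sum => // j jS.
rewrite f_g // -scalerA; apply: (NJ (ST jS)); apply: cN => //.
exact: (deviation_divisible phiG phiD Ad Gd jS).
Qed.

(** Multiplication by a fixed element on either side is an additive endomorphism
    of [G], so the result for endomorphisms is enough. *)
Lemma absolute_ideal_sum : absolute_ideal G J.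
Proof.
have oneside mu h x : multiplication G mu -> G h -> J x -> J (mu h x).
  move=> [muG muDl muDr] Gh [_ /gen1P[k ->] [_ [y Ny ->] <-]].
  have phiG z : G z -> G (mu h z) by apply: muG.
  have phiD z w : G z -> G w -> mu h (z + w) = mu h z + mu h w by apply: muDr.
  suff : [set z | G z /\ J (mu h z)] (g *~ k + \sum_(t \in T) y t) by case.
  have sK : subgroup [set z | G z /\ J (mu h z)].
    have mu0 : mu h 0 = 0.
      by have G0 := subgroup0 sG; apply: (addrI (mu h 0)); rewrite -phiD // !addr0.
    split=> [|z w [Gz Jz] [Gw Jw]].
      by split; [exact: subgroup0|rewrite mu0; apply: subgroup0].
    have GNw := subgroupN sG Gw; split; first exact: subgroupD.
    rewrite phiD //; suff -> : mu h (- w) = - mu h w by apply: subgroupB.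
    by apply/eqP; rewrite -addr_eq0 -phiD // addNr mu0.
  apply: (subgroupD sK).
    by apply: (subgroupMz _ sK); split=> //; apply: endomorphism_generator.
  apply: subgroup_fsum => // t Tt; split; first exact: (GM Tt (NM Tt (Ny t Tt))).
  by apply: (NJ Tt); apply: N_endo (Ny t Tt).
split=> //.
  apply: addset_sub => // [x /gen1P[k ->]|]; first exact: subgroupMz.
  by apply: sumset_sub => // t Tt x /(NM Tt)/(GM Tt).
move=> mu mult h x Gh Jx; split; first exact: oneside.
apply: (oneside (fun y z => mu z y)) => //; case: mult => muG muDl muDr.
by split=> *; [apply: muG|apply: muDr|apply: muDl].
Qed.

End Ideal.

(** The converse uses the multiplications that send a pair to the product of
    their [j]-th coordinates times a fixed [w]: multiplying [g] by [d] and by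
    the basis element gives two multiples of [c j *: w] with coprime factors. *)
Lemma absolute_ideal_contains H j w : absolute_ideal G H -> H g -> j \in S ->
  M j.1 w -> H (c j *: w).
Proof.
move=> [sH HG idH] Hg jS Mw; have Tj := ST jS.
have m0 : (m j)%:R != 0 :> rat by rewrite pnatr_eq0 -lt0n; apply: m_gt0.
pose F x := (m j)%:R * f j x.
have FD x y : F (x + y) = F x + F y by rewrite /F fD mulrDr.
pose mu x y := (F x * F y) *: w.
have mult : multiplication G mu.
  split=> [x y Gx Gy|x x' y _ _ _|x y y' _ _ _].
  - by apply: (GM Tj); apply: M_scale => //; apply: RtM; apply: f_Rt.
  - by rewrite /mu FD mulrDl scalerDl.
  - by rewrite /mu FD mulrDr scalerDl.
have Fg : F g = c j by rewrite /F f_g // mulrC divfK.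
have Fd : F d = (s j)%:~R by rewrite /F f_d // mulrC divfK.
have FE : F (E j) = (m j)%:R.
  rewrite /F; suff -> : f j (E j) = 1 by rewrite mulr1.
  have -> : E j = \sum_(k <- S) (k == j)%:R *: E k.
    rewrite (bigD1_seq j) //= eqxx scale1r big1 ?addr0 // => k /negPf ->.
    by rewrite scale0r.
  by rewrite (fE (fun k => (k == j)%:R)) // eqxx.
have Gd : G d.
  rewrite GE; exists d; first by apply/gen1P; exists 1; rewrite mulr1z.
  by exists 0; [exact: subgroup0|rewrite addr0].
have [_ H1] := idH mu mult d g Gd Hg.
have [_ H2] := idH mu mult (E j) g (GE_E jS) Hg.
have /coprimezP[[x y] /= xy] := sm jS.
have -> : c j *: w = mu g d *~ x + mu g (E j) *~ y.
  rewrite /mu Fg Fd FE -!scaler_int !scalerA -scalerDl; congr (_ *: _).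
  rewrite mulrCA [X in _ + X]mulrCA -mulrDr pmulrn -!intrM -intrD xy.
  by rewrite mulr1.
by apply: (subgroupD sH); apply: (subgroupMz _ sH).
Qed.

End Core.

(** * The basis and the coordinates of the group *)

Section BasisIndex.
Variables (TB TC : set gtype) (IC : gtype -> set nat).
Hypotheses (fB : finite_set TB) (fC : finite_set TC)
  (fI : forall t, TC t -> finite_set (IC t)) (I0 : forall t, TC t -> ~ IC t 0%N).

Definition basis_index : seq (gtype * nat) :=
  [seq (t, 0%N) | t <- fset_set TB] ++
  [seq (t, i) | t <- fset_set TC, i <- fset_set (IC t)].

Lemma mem_basis_index t i : (t, i) \in basis_index <->
  (TB t /\ i = 0%N) \/ (TC t /\ IC t i).
Proof.
rewrite mem_cat; split=> [/orP[/mapP[u]|/allpairsPdep[u [k []]]]|].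
- by rewrite in_fset_set // inE => Tu [-> ->]; left.
- rewrite in_fset_set // inE => Tu; rewrite in_fset_set ?inE; last exact: fI.
  by move=> Ik [-> ->]; right.
case=> [[Tt ->]|[Tt It]]; apply/orP; [left|right].
  by apply/mapP; exists t; rewrite // in_fset_set // inE.
apply/allpairsPdep; exists t, i; split=> //; rewrite in_fset_set ?inE //.
exact: fI.
Qed.

Lemma basis_index_uniq : uniq basis_index.
Proof.
rewrite cat_uniq map_inj_uniq ?fset_uniq /=; last by move=> t u [].
apply/andP; split; last first.
  apply: (@allpairs_uniq_dep _ (fun=> nat) _ (fun t i => (t, i))) => [|t _|];
    [exact: fset_uniq|exact: fset_uniq|].
  by move=> [t i] [u k] _ _ /= [-> ->].
apply/hasPn => _ /allpairsPdep[t [i [tC iI ->]]].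
move: tC iI; rewrite in_fset_set // inE => Tt; rewrite in_fset_set ?inE; last exact: fI.
by move=> Ii; apply/negP => /mapP[u _ [_ i0]]; apply: (I0 Tt); rewrite -i0.
Qed.

Lemma sum_basis_index (V : zmodType) (F : gtype * nat -> V) :
  \sum_(j <- basis_index) F j
  = \sum_(t \in TB) F (t, 0%N) + \sum_(t \in TC) \sum_(i \in IC t) F (t, i).
Proof.
rewrite big_cat big_map big_allpairs_dep !fsbig_finite //=; congr (_ + _).
rewrite big_seq [RHS]big_seq; apply: eq_bigr => t.
by rewrite in_fset_set // inE => Tt; rewrite fsbig_finite //; apply: fI.
Qed.

End BasisIndex.

Section BasisSum.
Variable V : vectType rat.
Variables (B C : set V) (TB : set gtype) (IC : gtype -> set nat)
  (e : gtype -> nat -> V).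
Let TC := crit C.
Let S := basis_index TB TC IC.
Hypotheses (fB : finite_set TB) (fC : finite_set TC)
  (fI : forall t, TC t -> finite_set (IC t)) (I0 : forall t, TC t -> ~ IC t 0%N)
  (sC : subgroup C) (BC0 : B `&` C = [set 0])
  (basB : is_basis TB Rt (e^~ 0%N) B)
  (basC : forall t, TC t -> is_basis (IC t) (fun=> Rt t) (e t) (homog C t)).

Lemma basis_sum_independent : independent TC (homog C) ->
  forall z : gtype * nat -> int, \sum_(j <- S) e j.1 j.2 *~ z j = 0 ->
  forall j, j \in S -> z j = 0.
Proof.
move=> indC z; rewrite sum_basis_index //=; set b := \sum_(t \in TB) _ => sz.
have [BE freeB] := basB.
have bE : b = \sum_(t \in TB) (z (t, 0%N))%:~R *: e t 0%N.
  by apply: eq_fsbigr => t _; rewrite scaler_int.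
have cE t : \sum_(i \in IC t) e t i *~ z (t, i)
    = \sum_(i \in IC t) (z (t, i))%:~R *: e t i.
  by apply: eq_fsbigr => i _; rewrite scaler_int.
have Cc t : TC t -> homog C t (\sum_(i \in IC t) e t i *~ z (t, i)).
  move=> Tt; have [-> _] := basC Tt; rewrite cE.
  by exists (fun i => (z (t, i))%:~R) => // i _; apply: Rt_int.
have b0 : b = 0.
  have : (B `&` C) b.
    split; first by rewrite BE bE; exists (fun t => (z (t, 0%N))%:~R) => // t _; apply: Rt_int.
    have -> : b = - \sum_(t \in TC) \sum_(i \in IC t) e t i *~ z (t, i).
      by apply/eqP; rewrite -addr_eq0 sz.
    apply: (subgroupN sC); apply: (subgroup_fsum sC) => t Tt.
    by apply: homog_sub (Cc t Tt).
  by rewrite BC0.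
have c0 : \sum_(t \in TC) \sum_(i \in IC t) e t i *~ z (t, i) = 0.
  by move: sz; rewrite b0 add0r.
case=> t i /mem_basis_index[]// => [[Tt ->]|[Tt It]]; apply/eqP; rewrite -(intr_eq0 rat).
  apply/eqP; apply: (freeB (fun t => (z (t, 0%N))%:~R)) => //.
    by move=> u _; apply: Rt_int.
  by rewrite -bE.
have [_ freeC] := basC Tt; apply/eqP; apply: (freeC (fun i => (z (t, i))%:~R)) => //.
  by move=> k _; apply: Rt_int.
by rewrite -cE; apply: (indC (fun t => \sum_(i \in IC t) e t i *~ z (t, i))).
Qed.

Lemma basis_sum_span x : C = sumset TC (homog C) -> addset B C x ->
  exists2 q : gtype * nat -> rat, forall j, j \in S -> Rt j.1 (q j)
    & x = \sum_(j <- S) q j *: e j.1 j.2.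
Proof.
move=> CE [b Bb [y Cy <-]]; move: Bb Cy.
have [-> _] := basB; rewrite CE => -[qb Rb ->] [w hw ->].
have /choice[qc qcP] : forall t, exists q : nat -> rat, TC t ->
    (forall i, IC t i -> Rt t (q i)) /\ w t = \sum_(i \in IC t) q i *: e t i.
  move=> t; have [Tt|nT] := pselect (TC t); last by exists (fun=> 0).
  have [hE _] := basC Tt; have := hw t Tt; rewrite hE => -[q Rq wq].
  by exists q.
exists (fun j => if j.2 == 0%N then qb j.1 else qc j.1 j.2).
  case=> t i /mem_basis_index[]// => [[Tt ->]|[Tt It]] /=; first exact: Rb.
  case: eqP It => [->|_] It; first by case: (I0 Tt).
  by case: (qcP t Tt) => + _; apply.
rewrite sum_basis_index //=; congr (_ + _); apply: eq_fsbigr => t.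
rewrite inE => Tt; have [_ ->] := qcP t Tt; apply: eq_fsbigr => i.
rewrite inE /= => It; case: eqP => [i0|//].
by case: (I0 Tt); rewrite -i0.
Qed.

End BasisSum.

Section Regularity.
Variable V : vectType rat.

Lemma cd_trivial : completely_decomposable [set 0 : V].
Proof.
exists 0%N, (fun=> [set 0]); split; [by case|by move=> x _ _ []|].
apply/seteqP; split=> [_ ->|_ [x _ ->]]; last by rewrite fsum_ordT big_ord0.
by exists (fun=> 0); [case|rewrite fsum_ordT big_ord0].
Qed.

(** A basis of [B] indexed by its critical types certifies that [B] has a
    decomposition: otherwise it has no critical type, so the basis is empty. *)
Lemma basis_cd (B : set V) (e : gtype -> nat -> V) :
  is_basis (crit B) Rt (e^~ 0%N) B -> completely_decomposable B.
Proof.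
move=> [BE _]; have [[t [x /homog_cd //]]|/forallNP nB] := pselect (exists t, crit B t).
suff -> : B = [set 0] by exact: cd_trivial.
rewrite BE; apply/seteqP; split=> [_ [a _ ->]|_ ->]; first by apply: fsbig1 => t /nB.
by exists (fun=> 0) => [t /nB|]; rewrite ?fsbig1 // => t /nB.
Qed.

(** A non-zero [minv G t] counts cosets of a homogeneous component, which must
    then be non-empty; without a decomposition all components are empty. *)
Lemma minv_cd (G : set V) t : minv G t != 0%N -> completely_decomposable (Reg G).
Proof.
rewrite /minv /Defs.index; set P := (X in xget _ X).
have [/(xgetPex 0%N)|/forallNP nP] := pselect (exists n, P n); last first.
  by rewrite xgetPN ?eqxx.
case: (xget _ _) => // n [c [Gc cP]] _.
by have [i [/homog_cd]] := cP _ (Gc ord0).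
Qed.

(** If [Reg G1] has no critical type then it vanishes, so [G1] vanishes too and
    [G = C] is its own regulator. *)
Lemma Reg_cd (G G1 C : set V) (e : gtype -> nat -> V) :
  ACD G -> ACD G1 -> completely_decomposable C -> G = addset G1 C ->
  is_basis (crit (Reg G1)) Rt (e^~ 0%N) (Reg G1) ->
  (forall t, crit (Reg G1) t -> minv G t != 0%N) ->
  completely_decomposable (Reg G).
Proof.
move=> aG aG1 cC GE bas m0.
have [[t /m0 /minv_cd //]|/forallNP nB] := pselect (exists t, crit (Reg G1) t).
have B0 x : Reg G1 x -> x = 0.
  by have [-> _] := bas => -[a _ ->]; apply: fsbig1 => t /nB.
have G1E x : G1 x -> x = 0.
  have [N N0 GB] := Reg_bounded aG1 => /GB /B0; exact: mulrn_eq0.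
have [sG1 _] := aG1.
have GC : G = C.
  rewrite GE; apply/seteqP; split=> [_ [x /G1E -> [y Cy <-]]|y Cy]; first by rewrite add0r.
  by exists 0; [exact: subgroup0|exists y; rewrite ?add0r].
suff -> : Reg G = C by [].
by apply: Reg_greatest => // [|K k _ KG _]; rewrite -GC.
Qed.

Lemma independent_sub (I : choiceType) (D D' : set I) (X Y : I -> set V) :
  finite_set D -> independent D X -> D' `<=` D -> (forall i, D i -> X i 0) ->
  (forall i, D' i -> Y i `<=` X i) -> independent D' Y.
Proof.
move=> fD indX DD X0 YX y Yy sy i D'i.
have := indX (fun i => if i \in D' then y i else 0) _ _ i (DD i D'i).
rewrite mem_set //; apply.
  by move=> k Dk; case: ifPn => [|_]; [rewrite inE => D'k; apply/YX/Yy|exact: X0].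
by rewrite -fsbig_mkcondr setIidr.
Qed.

End Regularity.

Section Ell.
Variables (t : gtype) (IC : gtype -> set nat) (r : gtype -> rat)
  (a : gtype -> nat -> rat).
Hypotheses (Rr : Rt t (r t)) (Ra : forall i, IC t i -> Rt t (a t i))
  (fI : finite_set (IC t)).

Lemma dvdn_bar n b : Rt t b -> (n %| bar t b)%N ->
  exists2 q, Rt t q & b = n%:R * q.
Proof.
move=> /barP[u [Ru _ _ e]] /dvdnP[k bk]; exists (k%:R * u).
  by apply: RtM => //; exact: (Rt_int t k).
by rewrite {1}e bk natrM mulrA [n%:R * _]mulrC.
Qed.

Lemma ell_r : exists2 q, Rt t q & r t = (ell IC r a t)%:R * q.
Proof. by apply: dvdn_bar => //; apply: dvdn_gcdl. Qed.

Lemma ell_a i : IC t i -> exists2 q, Rt t q & a t i = (ell IC r a t)%:R * q.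
Proof.
move=> Ii; apply: dvdn_bar; first exact: Ra.
exact: dvdn_trans (dvdn_gcdr _ _) (dvdn_biggcd _ fI Ii).
Qed.

(** The normalised coefficients are unit multiples of the original ones and are
    integers, so the Bezout identity for their gcd can be used inside [H]. *)
Lemma ell_sub (V : vectType rat) (H M : set V) : subgroup H ->
  (forall q x, Rt t q -> M x -> M (q *: x)) ->
  (forall x, M x -> H (r t *: x)) ->
  (forall i x, IC t i -> M x -> H (a t i *: x)) ->
  forall x, M x -> H ((ell IC r a t)%:R *: x).
Proof.
move=> sH MR Hr Ha x Mx.
have Hbar b : Rt t b -> (forall x, M x -> H (b *: x)) -> H (x *+ bar t b).
  move=> /barP[u [_ Ru u0 e]] Hb.
  have -> : x *+ bar t b = b *: (u^-1 *: x).
    by rewrite {2}e scalerA mulfK // scaler_nat.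
  exact/Hb/MR.
rewrite scaler_nat; apply: subgroup_gcd => //; first exact: Hbar.
apply: subgroup_biggcd => // i Ii; apply: Hbar; first exact: Ra.
by move=> y; apply: Ha.
Qed.

End Ell.

(** * The principal absolute ideal *)

Theorem theorem2p4 (V : vectType rat) (G G1 C A B : set V) (d : V)
    (IC : gtype -> set nat) (e : gtype -> nat -> V) (s : gtype -> int)
    (g : V) (r : gtype -> rat) (a : gtype -> nat -> rat)
    (G_CRQ : CRQ G) (G_block_rigid : block_rigid G) (G_ring_type : ring_type G)
    (A_def : A = Reg G)
    (G_dec : principal_decomposition G G1 C)
    (B_def : B = Reg G1)
    (E_basis : r_basis G G1 C d IC e s)
    (r_in : forall t, crit B t -> Rt t (r t))
    (r_out : forall t, crit A t -> ~ crit B t -> r t = 0)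
    (a_in : forall t i, crit C t -> IC t i -> Rt t (a t i))
    (g_def : g = \sum_(t \in crit B) (r t / (minv G t)%:R) *: e t 0%N
               + \sum_(t \in crit C) \sum_(i \in IC t) a t i *: e t i)
    (g_in : G g) :
  let rA t := scaleset (r t) (homog A t) in
  let aA t := sumset (IC t) (fun i => scaleset (a t i) (homog A t)) in
  let lA t := scaleset (ell IC r a t)%:R (homog A t) in
  [/\ independent (crit B) rA, independent (crit C) aA,
      independent (crit A) lA,
      principal_AI G g = addset (addset (gen [set g]) (sumset (crit B) rA))
                                (sumset (crit C) aA)
    & principal_AI G g = addset (gen [set g]) (sumset (crit A) lA)].
Proof.
have [aG _] := G_CRQ; have [sG _] := aG.
have [[sG1 sC GE G1C] [cC _] [[aG1 _] [_ r1B]] _ _] := G_dec.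
have [[[G1d cyc] e0_in basB dE cop] basICs ICe] := E_basis.
rewrite /TG -B_def in r1B e0_in basB dE cop.
set TB := crit B in r1B e0_in basB dE cop r_in r_out g_def *.
set TC := crit C in basICs ICe a_in g_def *.
have cB : completely_decomposable B by apply: basis_cd basB.
have m0 t : TB t -> minv G t != 0%N.
  by move=> Bt; have [_ _ []] := cop t Bt.
have cA : completely_decomposable A.
  rewrite A_def; apply: (@Reg_cd _ G G1 C e) => //; first by rewrite -B_def.
  by move=> t; rewrite -B_def; apply: m0.
have idA t : crit A t -> idempotent_type t by rewrite A_def; apply: G_ring_type.
have sepA : separated (crit A).
  apply: incomparable_separated idA _ => u t; rewrite A_def.
  exact: G_block_rigid.
pose T := crit A.
have T_BC : T = TB `|` TC.
  by rewrite /T /TB A_def B_def; apply: crit_Reg_sum; rewrite -?A_def -?B_def.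
have TBT : TB `<=` T by rewrite T_BC => t; left.
have TCT : TC `<=` T by rewrite T_BC => t; right.
have AE : A = addset B C.
  rewrite A_def B_def; apply: Reg_sum; rewrite -?A_def -?B_def //.
have hE t : T t -> homog A t = addset (homog B t) (homog C t).
  by rewrite /T A_def B_def; apply: homog_Reg_sum; rewrite -?A_def -?B_def.
have pureA t x n : T t -> G x -> (0 < n)%N -> homog A t (x *+ n) -> homog A t x.
  rewrite /T A_def; apply: (@homogA_pure _ G G1 C); rewrite -?A_def -?B_def //.
have sA : subgroup A := completely_decomposable_subgroup cA.
have AG : A `<=` G by rewrite A_def; apply: Reg_sub.
have fT : finite_set T := finite_crit cA.
have fB : finite_set TB := finite_crit cB.
have fC : finite_set TC := finite_crit cC.
have sM t : T t -> subgroup (homog A t).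
  by apply: subgroup_homog => // u; apply: idA.
have M_scale t q x : T t -> Rt t q -> homog A t x -> homog A t (q *: x).
  by move=> Tt; apply: (homog_scale cA (fun _ h => h) idA sepA Tt).
have hP t x (Tt : T t) := @homogP _ A T cA (fun _ h => h) idA sepA t x Tt.
have fI t : TC t -> finite_set (IC t) by move=> /basICs[].
have I0 t : TC t -> ~ IC t 0%N by move=> /basICs[].
have basC t : TC t -> is_basis (IC t) (fun=> Rt t) (e t) (homog C t).
  by move=> /basICs[].
have fIT t : finite_set (IC t).
  have [/fI //|nC] := pselect (TC t); by rewrite (ICe t nC).
have IC_TC t i : IC t i -> TC t.
  by move=> It; apply: contrapT => nC; move: It; rewrite (ICe t nC).
have BC_0 : B `&` C = [set 0].
  by rewrite B_def; apply: BC0.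
have CE : C = sumset TC (homog C).
  exact: (@sumset_homog _ C T cC TCT idA sepA).
have indC : independent TC (homog C).
  exact: (@independent_homog _ C T cC TCT idA sepA).
pose S := basis_index TB TC IC; pose E (j : gtype * nat) := e j.1 j.2.
have memS t i := @mem_basis_index TB TC IC fB fC fI t i.
have uS : uniq S by apply: basis_index_uniq.
have sumS (F : gtype * nat -> V) : \sum_(j <- S) F j
    = \sum_(t \in TB) F (t, 0%N) + \sum_(t \in TC) \sum_(i \in IC t) F (t, i).
  exact: sum_basis_index.
have indS := basis_sum_independent fB fC fI sC BC_0 basB basC indC.
have spanS x : A x -> exists2 q : gtype * nat -> rat,
    forall j, j \in S -> Rt j.1 (q j) & x = \sum_(j <- S) q j *: E j.
  by rewrite AE; apply: basis_sum_span.
have [f [fD fZ fE]] := dual_family (v := E) uS indS.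
have fMn j x n : f j (x *+ n) = f j x *+ n.
  by rewrite -scaler_nat fZ mulr_natl.
have fMz j x z : f j (x *~ z) = f j x *~ z.
  by rewrite -scaler_int fZ mulrzl.
have f_A j x : j \in S -> A x -> Rt j.1 (f j x).
  by move=> jS /spanS[q Rq ->]; rewrite fE //; apply: Rq.
have expandA x : A x -> x = \sum_(j <- S) f j x *: E j.
  move=> /spanS[q _ xE]; rewrite {1}xE big_seq [RHS]big_seq.
  by apply: eq_bigr => j jS; rewrite {1}xE fE.
have [N N0 GA] := Reg_bounded aG; rewrite -A_def in GA.
have f_expand x : G x -> x = \sum_(j <- S) f j x *: E j.
  move=> /GA Ax; apply: (mulrn_inj N0); rewrite -sumrMnl {1}(expandA _ Ax).
  by apply: eq_bigr => j _; rewrite fMn scalerMnl.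
have ST j : j \in S -> T j.1.
  by case: j => t i /memS[[/TBT]|[/TCT]].
have EM j : j \in S -> homog A j.1 (E j).
  case: j => t i /memS jS; have Tt : T t by case: jS => -[] => [/TBT|/TCT].
  rewrite hE //; case: jS => [[Bt ->]|[Ct It]].
    exists (e t 0%N); first exact: e0_in.
    exists 0; last by rewrite addr0.
    by apply: subgroup0; apply: (subgroup_homog cC TCT idA sepA Tt).
  exists 0.
    by apply: subgroup0; apply: (subgroup_homog cB TBT idA sepA Tt).
  exists (e t i); last by rewrite add0r.
  have [-> _] := basC t Ct; exists (fun k => (k == i)%:R) => [k _|].
    exact: (Rt_int t (k == i)).
  have fIt := fIT t; rewrite (fsbigD1 i) //= eqxx scale1r.
  rewrite fsbig1 ?addr0 // => k [_ /= /eqP/negPf ->].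
  by rewrite scale0r.
have f_off t x j : T t -> homog A t x -> j \in S -> j.1 <> t -> f j x = 0.
  move=> Tt /(hP _ _ Tt)[Ax dx] jS jt.
  have [p [tp np]] := sepA _ _ Tt (ST j jS) (nesym jt).
  apply: (Rt_inf_div np (f_A j x jS Ax)) => k; have [y Ay ->] := dx p tp k.
  by exists (f j y); [apply: f_A|rewrite fMn].
have M_endo phi t x : (forall y, G y -> G (phi y)) ->
    (forall y z, G y -> G z -> phi (y + z) = phi y + phi z) ->
    T t -> homog A t x -> homog A t (phi x).
  move=> phiG phiD Tt /(hP _ _ Tt)[Ax dx]; have Gx := AG x Ax.
  apply: (pureA t _ N Tt (phiG x Gx) N0); apply/(hP _ _ Tt).
  split=> [|p Pp]; first exact/GA/phiG.
  apply: (inf_div_mulrn GA) => k; apply: (divides_in_morph sG phiG phiD).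
  exact: (inf_div_sub AG (dx p Pp)).
(* The coordinates of [g] and [d]; [IC] avoids 0, so the second index tells the
   two kinds of basis elements apart. *)
pose c (j : gtype * nat) := if j.2 == 0%N then r j.1 else a j.1 j.2.
pose s' (j : gtype * nat) := if j.2 == 0%N then s j.1 else 0.
pose m (j : gtype * nat) := if j.2 == 0%N then minv G j.1 else 1%N.
have S_cases (P : gtype * nat -> Prop) : (forall t, TB t -> P (t, 0%N)) ->
    (forall t i, TC t -> IC t i -> i != 0%N -> P (t, i)) -> forall j, j \in S -> P j.
  move=> PB PC [t i] /memS[[Bt ->]|[Ct It]]; first exact: PB.
  by apply: PC => //; apply: contra_notN (I0 t Ct) => /eqP <-.
have m_gt0 j : j \in S -> (0 < m j)%N.
  move: j; apply: S_cases => [t /m0|t i _ _ /negPf i0]; rewrite /m /= ?i0 //.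
  by rewrite lt0n.
have sm j : j \in S -> coprimez (s' j) (m j)%:Z.
  move: j; apply: S_cases => [t Bt|t i _ _ /negPf i0]; rewrite /s' /m /= ?i0 //.
  by have [] := cop t Bt.
have s_uniq j k : j \in S -> k \in S -> j.1 = k.1 -> s' j != 0 -> s' k != 0 -> j = k.
  move=> _ _; case: j k => [t i] [u k]; rewrite /s' /= => ->.
  by case: (i =P 0%N) => [->|_]; case: (k =P 0%N) => [->|_]; rewrite ?eqxx.
have coordE (x : V) (q : gtype * nat -> rat) :
    x = \sum_(t \in TB) q (t, 0%N) *: e t 0%N
        + \sum_(t \in TC) \sum_(i \in IC t) q (t, i) *: e t i ->
    forall j, j \in S -> f j x = q j.
  by move=> xE j jS; rewrite -(fE q j jS) sumS -xE.
have IC_neq0 t i : TC t -> IC t i -> (i == 0%N) = false.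
  by move=> Ct It; apply/eqP => i0; apply: (I0 t Ct); rewrite -i0.
have f_d j : j \in S -> f j d = (s' j)%:~R / (m j)%:R.
  apply: (coordE d (fun j => (s' j)%:~R / (m j)%:R)); rewrite {1}dE -[LHS]addr0.
  congr (_ + _); apply/esym/fsbig1 => t Ct; apply: fsbig1 => i It.
  by rewrite /s' /= (IC_neq0 t) // mul0r scale0r.
have f_g j : j \in S -> f j g = c j / (m j)%:R.
  apply: (coordE g (fun j => c j / (m j)%:R)); rewrite {1}g_def.
  congr (_ + _); apply: eq_fsbigr => t; rewrite inE => Ct.
  apply: eq_fsbigr => i; rewrite inE => It.
  by rewrite /c /m /= (IC_neq0 t) // divr1.
have GAE : G = addset (gen [set d]) A by rewrite A_def; case: cyc.
have f_Rt j x : j \in S -> G x -> Rt j.1 ((m j)%:R * f j x).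
  move=> jS; rewrite GAE => -[_ /gen1P[k ->] [y Ay <-]].
  have mj0 : (m j)%:R != 0 :> rat by rewrite pnatr_eq0 -lt0n; apply: m_gt0.
  rewrite fD fMz f_d // mulrDr -mulrzl mulrCA mulrC [_ * (_ / _)]mulrC divfK //.
  apply: RtD; first by rewrite -intrM; apply: Rt_int.
  by apply: RtM; [exact: (Rt_int _ (m j))|apply: f_A].
have AT : A = sumset T (homog A) by apply: (@sumset_homog _ A T cA).
have Rr t : T t -> Rt t (r t).
  move=> Tt; have [Bt|nB] := pselect (TB t); first exact: r_in.
  by rewrite r_out //; apply: Rt0.
have Ra t i : IC t i -> Rt t (a t i) by move=> It; apply: a_in => //; apply: IC_TC It.
move=> rA aA lA.
have lA_M t : T t -> lA t `<=` homog A t.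
  move=> Tt _ [x Mx <-]; apply: M_scale => //; exact: (Rt_int t (ell IC r a t)).
have rA_M t : TB t -> rA t `<=` homog A t.
  by move=> Bt _ [x Mx <-]; apply: M_scale => //; [apply: TBT|apply: r_in].
have aA_M t : TC t -> aA t `<=` homog A t.
  move=> Ct; apply: sumset_sub => [|i It _ [x Mx <-]]; first exact/sM/TCT.
  by apply: M_scale => //; [apply: TCT|apply: a_in].
have slA t : T t -> subgroup (lA t) by move=> /sM; apply: subgroup_scaleset.
have srA t : TB t -> subgroup (rA t) by move=> /TBT/sM; apply: subgroup_scaleset.
have saA t : TC t -> subgroup (aA t).
  move=> Ct; apply: subgroup_sumset => // i _.
  by apply: subgroup_scaleset; apply/sM/TCT.
have indA : independent T (homog A) by apply: (@independent_homog _ A T cA).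
have M0 t : T t -> homog A t 0 by move=> /sM /subgroup0.
have cN j w : j \in S -> homog A j.1 w -> lA j.1 (c j *: w).
  move=> jS; move: j jS w; apply: S_cases => [t Bt w|t i Ct It i0 w] /=;
    rewrite /c /= => Mw.
    have [q Rq ->] := ell_r IC a (Rr t (TBT t Bt)).
    by exists (q *: w); rewrite ?scalerA //; apply: M_scale => //; apply: TBT.
  rewrite (negPf i0); have [q Rq ->] := ell_a r (Ra t) (fIT t) It.
  by exists (q *: w); rewrite ?scalerA //; apply: M_scale => //; apply: TCT.
have l_endo phi t x : (forall y, G y -> G (phi y)) ->
    (forall y z, G y -> G z -> phi (y + z) = phi y + phi z) ->
    T t -> lA t x -> lA t (phi x).
  move=> phiG phiD Tt [y My <-]; exists (phi y).
    exact: (M_endo _ _ _ phiG phiD Tt My).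
  have Gy : G y := AG _ (homog_sub My).
  have phi0 : phi 0 = 0.
    have G0 := subgroup0 sG; apply: (addrI (phi 0)).
    by rewrite -phiD // !addr0.
  rewrite !scaler_nat; elim: (ell _ _ _ _) => [|n IHn]; first by rewrite !mulr0n.
  by rewrite !mulrS phiD ?IHn //; apply: subgroupMn.
(* The ideal lies in [J], [J] in [K] by the Bezout identity, and [K] in the
   ideal. *)
pose J := addset (gen [set g]) (sumset T lA).
pose K := addset (addset (gen [set g]) (sumset TB rA)) (sumset TC aA).
have sgR : subgroup (addset (gen [set g]) (sumset TB rA)).
  by apply: subgroup_addset; [exact: subgroup_gen|exact: subgroup_sumset].
have sK : subgroup K by apply: subgroup_addset => //; apply: subgroup_sumset.
have gJ : absolute_ideal G J.
  exact: (absolute_ideal_sum sG AG fT sM AT GAE g_in uS ST EM fD fZ f_expand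
    f_off M_endo m_gt0 sm s_uniq f_d f_g slA lA_M cN l_endo).
have g1 : gen [set g] g by apply/gen1P; exists 1; rewrite mulr1z.
have PJ : principal_AI G g `<=` J.
  move=> x; apply; split=> // _ ->; exists g => //; exists 0; last by rewrite addr0.
  exact: subgroup0 (subgroup_sumset fT slA).
have R0 := subgroup0 (subgroup_sumset fB srA).
have A0 := subgroup0 (subgroup_sumset fC saA).
have gK x : gen [set g] x -> K x.
  move=> gx; exists x; last by exists 0; [exact: A0|rewrite addr0].
  by exists x => //; exists 0; [exact: R0|rewrite addr0].
have rK t x : TB t -> rA t x -> K x.
  move=> Bt rx; exists x; last by exists 0; [exact: A0|rewrite addr0].
  exists 0; first exact: subgroup0 (subgroup_gen _).
  exists x; last by rewrite add0r.
  by apply: (sub_sumset _ Bt rx) => u /srA /subgroup0.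
have aK t x : TC t -> aA t x -> K x.
  move=> Ct ax; exists 0; first exact: subgroup0 sgR.
  exists x; last by rewrite add0r.
  by apply: (sub_sumset _ Ct ax) => u /saA /subgroup0.
have JK : J `<=` K.
  apply: addset_sub => //; apply: sumset_sub => // t Tt _ [x Mx <-].
  apply: (ell_sub (Rr t Tt) (Ra t) (fIT t) sK _ _ _ Mx).
  - by move=> q y; apply: M_scale.
  - move=> y My; have [Bt|nB] := pselect (TB t).
      by apply: (rK t) => //; exists y.
    by rewrite r_out // scale0r; apply: subgroup0.
  move=> i y It My; apply: (aK t); first exact: IC_TC It.
  apply: (@sub_sumset _ _ _ _ i) => //; last by exists y.
  by move=> k _; exists 0; [exact: M0|rewrite scaler0].
have KP : K `<=` principal_AI G g.
  move=> x Kx H [idH /(_ g erefl) Hg]; have [sH _ _] := idH.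
  have Hc j w : j \in S -> homog A j.1 w -> H (c j *: w).
    move=> jS Mw; exact: (absolute_ideal_contains AG fT sM AT GAE uS ST EM fD fE
      M_scale m_gt0 sm f_d f_g f_Rt idH Hg jS Mw).
  move: x Kx; apply: addset_sub => //; first apply: addset_sub => //.
  - by move=> _ /gen1P[k ->]; apply: subgroupMz.
  - apply: sumset_sub => // t Bt _ [x Mx <-].
    by apply: (Hc (t, 0%N)) => //; apply/memS; left.
  apply: sumset_sub => // t Ct; apply: sumset_sub => // i It _ [x Mx <-].
  have := Hc (t, i) x; rewrite /c /= (IC_neq0 t) //; apply => //.
  by apply/memS; right.
split.
- exact: independent_sub fT indA TBT M0 rA_M.
- exact: independent_sub fT indA TCT M0 aA_M.
- exact: independent_sub fT indA (fun _ h => h) M0 lA_M.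
- by apply/seteqP; split; [move=> x /PJ/JK|exact: KP].
by apply/seteqP; split; [exact: PJ|move=> x /JK/KP].
Qed.
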